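(* Let $\omega$ be a regular weight in the class $\mathcal{W}$ and let $\phi:\mathbb{D}\to\mathbb{D}$ be analytic. If the composition operator $C_\phi f=f\circ\phi$ is bounded on $A^2(\omega)$, then for every $\zeta\in\partial\mathbb{D}$ $$\limsup_{z\to\zeta}\frac{\omega(z)}{\omega(\phi(z))}<\infty,$$ where $z$ tends to $\zeta$ within $\mathbb{D}$.
   Context: $\mathbb{D}$ is the open unit disk in $\mathbb{C}$, $dA$ is normalized area measure on $\mathbb{D}$, and $H(\mathbb{D})$ is the space of analytic functions on $\mathbb{D}$. For an integrable radial weight $\omega$ on $\mathbb{D}$, $A^2(\omega)$ is the space of $f\in H(\mathbb{D})$ with $\|f\|_{2,\omega}^2=\int_{\mathbb{D}}|f(z)|^2\omega(z)\,dA(z)<\infty$. Class $\mathcal{W}$: a weight $\omega$ belongs to $\mathcal{W}$ if it is an integrable radial function of the form $\omega(z)=e^{-\varphi(z)}$ with $\varphi\in\mathcal{C}^2(\mathbb{D})$ real-valued and radial, $\Delta\varphi(z)\ge C>0$ on $\mathbb{D}$ for some constant $C$, and the radial function $\tau(z):=(\Delta\varphi(z))^{-1/2}$ satisfies: $\tau(z)$ decreases to $0$ and $\tau'(z)\to0$ as $|z|\to1^-$ (derivative in the radial variable); and either $\tau(z)(1-|z|)^{-C}$ increases for some $C>0$, or $\lim_{|z|\to1^-}\tau'(z)\log\frac{1}{\tau(z)}=0$. Writing $\omega(r)$ for the value of the radial weight at $|z|=r$, $\omega$ is called regular if $\lim_{t\to0^+}\frac{\omega(1-\delta t)}{\omega(1-t)}=0$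 for every $0<\delta<1$. *)

(* Defs.v *)
From HB Require Import structures.
From mathcomp Require Import all_boot all_order all_algebra.
From mathcomp Require Import complex.
From mathcomp Require Import all_classical all_reals all_analysis.

Set Implicit Arguments.
Unset Strict Implicit.
Unset Printing Implicit Defensive.

Import Order.TTheory GRing.Theory Num.Theory.
Import numFieldNormedType.Exports.

Local Open Scope classical_set_scope.
Local Open Scope ring_scope.
Local Open Scope complex_scope.

Definition unit_disk (R : realType) : set R[i] := [set z | `|z| < 1].
Arguments unit_disk {R}.

Definition unit_circle (R : realType) : set R[i] := [set z | `|z| = 1].
Arguments unit_circle {R}.

(* [`|z|] has type [R[i]]; this is the modulus as a real number. *)
Definition cmod (R : realType) (z : R[i]) : R := ComplexField.Normc.normc z.

Definition pair_to_complex (R : realType) (p : R * R) : R[i] := p.1 +i* p.2.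

Definition disk_coord (R : realType) : set (R * R) :=
  @pair_to_complex R @^-1` unit_disk.
Arguments disk_coord {R}.

Lemma inv_pi_ge0 (R : realType) : 0 <= (pi : R)^-1.
Proof. by rewrite invr_ge0 pi_ge0. Qed.

(* Lebesgue measure on the plane divided by [pi], so that the disk has
   measure 1. *)
Definition dA (R : realType) :
    {measure set (measurableTypeR R * measurableTypeR R) -> \bar R} :=
  mscale (NngNum (inv_pi_ge0 R)) (@lebesgue_measure R \x @lebesgue_measure R)%E.

(* Functions on the disk are total functions on [R[i]]; their values off the
   disk never matter. *)
Definition holomorphic_on_disk (R : realType) (f : R[i] -> R[i]) : Prop :=
  forall z, unit_disk z -> derivable (f : R[i]^o -> R[i]^o) z 1.

Definition A2norm (R : realType) (w : R[i] -> R) (f : R[i] -> R[i]) : \bar R :=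
  sqrte (\int[dA R]_(p in disk_coord)
    (cmod (f (pair_to_complex p)) ^+ 2 * w (pair_to_complex p))%:E)%E.

Definition A2 (R : realType) (w : R[i] -> R) : set (R[i] -> R[i]) :=
  [set f | holomorphic_on_disk f /\ (A2norm w f < +oo)%E].

Definition composition_operator (R : realType) (phi : R[i] -> R[i])
  (f : R[i] -> R[i]) : R[i] -> R[i] := f \o phi.

Definition bounded_on_A2 (R : realType) (w : R[i] -> R)
    (T : (R[i] -> R[i]) -> (R[i] -> R[i])) : Prop :=
  (forall f, A2 w f -> A2 w (T f)) /\
  exists M : R, forall f, A2 w f -> (A2norm w (T f) <= M%:E * A2norm w f)%E.

(* Partial derivatives in the real coordinates of [z = x + i y]. *)
Definition dx_line (R : realType) (u : R[i] -> R) (z : R[i]) : R -> R :=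
  fun t => u (z + t%:C).

Definition dy_line (R : realType) (u : R[i] -> R) (z : R[i]) : R -> R :=
  fun t => u (z + t *i).

Definition partial_x (R : realType) (u : R[i] -> R) (z : R[i]) : R :=
  derive1 (dx_line u z) 0.

Definition partial_y (R : realType) (u : R[i] -> R) (z : R[i]) : R :=
  derive1 (dy_line u z) 0.

Definition C1_on_disk (R : realType) (u : R[i] -> R) : Prop :=
  forall z, unit_disk z ->
    [/\ derivable (dx_line u z) 0 1, derivable (dy_line u z) 0 1,
        {for z, continuous (partial_x u : R[i]^o -> R)} &
        {for z, continuous (partial_y u : R[i]^o -> R)}].

Definition C2_on_disk (R : realType) (u : R[i] -> R) : Prop :=
  [/\ C1_on_disk u, C1_on_disk (partial_x u) & C1_on_disk (partial_y u)].

Definition laplacian (R : realType) (u : R[i] -> R) (z : R[i]) : R :=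
  partial_x (partial_x u) z + partial_y (partial_y u) z.

Definition radial (R : realType) (u : R[i] -> R) : Prop :=
  forall z1 z2, unit_disk z1 -> unit_disk z2 -> `|z1| = `|z2| -> u z1 = u z2.

(* The value of a radial function at [|z| = r]. *)
Definition profile (R : realType) (u : R[i] -> R) (r : R) : R := u r%:C.

Definition tau (R : realType) (vphi : R[i] -> R) (z : R[i]) : R :=
  laplacian vphi z `^ (- 2^-1).

(* Monotonicity "as |z| -> 1-" is only required on some annulus
   [r0 <= |z| < 1], and is not strict. *)
Definition decreasing_near1 (R : realType) (g : R -> R) : Prop :=
  exists2 r0, 0 <= r0 < 1 & {in `[r0, 1[ &, {homo g : r s /~ r <= s}}.

Definition increasing_near1 (R : realType) (g : R -> R) : Prop :=
  exists2 r0, 0 <= r0 < 1 & {in `[r0, 1[ &, {homo g : r s / r <= s}}.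

(* [vphi] being [C^2] does not make [tau] differentiable, so the condition
   [tau' -> 0] carries the existence of [tau'] near 1. *)
Definition classW (R : realType) (w : R[i] -> R) : Prop :=
  [/\ (dA R).-integrable disk_coord (fun p => (w (pair_to_complex p))%:E),
      radial w &
      exists vphi : R[i] -> R,
        let t := profile (tau vphi) in
        [/\ C2_on_disk vphi /\ radial vphi,
            forall z, unit_disk z -> w z = expR (- vphi z),
            (exists2 C : R, 0 < C &
               forall z, unit_disk z -> C <= laplacian vphi z),
            [/\ decreasing_near1 t, t r @[r --> 1^'-] --> 0,
                (\forall r \near 1^'-, derivable t r 1) &
                derive1 t r @[r --> 1^'-] --> 0] &
            (exists2 C : R, 0 < C &
               increasing_near1 (fun r => t r * (1 - r) `^ (- C))) \/
            derive1 t r * ln ((t r)^-1) @[r --> 1^'-] --> 0]].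

Definition regular_weight (R : realType) (w : R[i] -> R) : Prop :=
  forall delta : R, 0 < delta < 1 ->
    profile w (1 - delta * t) / profile w (1 - t) @[t --> 0^'+] --> 0.

(* Main.v *)
Require Import Defs.
From mathcomp Require Import all_boot all_order all_algebra.
From mathcomp Require Import complex.
From mathcomp Require Import all_classical all_reals all_analysis.
From mathcomp Require Import measurable_realfun.
From mathcomp Require Import ring lra.
Import Order.TTheory GRing.Theory Num.Theory.
Import numFieldNormedType.Exports.
Local Open Scope classical_set_scope.
Local Open Scope ring_scope.
Local Open Scope complex_scope.

(** A bounded [C_phi] cannot raise the norm of point evaluations by more than
    its operator norm: evaluating [f \o phi] at [z] is evaluating [f] at
    [phi z].  For a weight of the class W the squared norm of evaluation at [z]
    is comparable, near the circle, to [1 / (w z * tau z ^+ 2)].  Hence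
    [w z * tau z ^+ 2 <= K * (w (phi z) * tau (phi z) ^+ 2)].  If
    [|phi z| <= |z|] the quotient [w z / w (phi z)] is at most 1, because [w]
    decreases radially ([Delta varphi > 0] makes [varphi] increase).  If
    [|phi z| > |z|] then [tau (phi z) <= tau z], because [tau] decreases near
    the circle, and the factors [tau] can be dropped.  So the quotient is
    bounded on a whole annulus next to the circle.

    Both estimates for the evaluation norm come from one computation in the
    variable [r = |z|] ([logmass_le], [logmass_near]).  With
    [a r = r * varphi' r] one has [a' r = r / tau r ^+ 2], so that for [n]
    close to [a r] the function [n * ln s - varphi s] is, up to a constant,
    maximal at [s = r], and it varies boundedly for [|s - r| <= tau r].

    - Upper bound ([point_evaluation]): for [u] in the disc of radius [tau z]
      about [z], [w u] is at least a constant times [w z * |z / u| ^+ (2 * N)]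
      for a suitable [N], so an unweighted area sub-mean value inequality for
      [g u * (z / u) ^+ N] suffices.

    - Lower bound ([test_function]): the function [q ^+ N * E q ^+ 2], where
      [q = u / p] and [E] is the average of the first [L] powers of [q], with
      [L] of order [1 / tau p], has the value 1 at [p], and its squared modulus
      times [w] decays away from [p] at the scale [tau p]; its norm squared is at most a constant times
      [w p * tau p ^+ 2].

    Holomorphic functions are only assumed to have a complex derivative at each
    point, so the sub-mean value inequality ([submean]) is obtained from a
    Goursat bisection argument.  It yields a divergence theorem for vector
    fields that are merely differentiable ([divergence_compact_support]), which
    is applied to the difference quotient of the function times a radial bump
    function. *)

Set Implicit Arguments.
Unset Strict Implicit.
Unset Printing Implicit Defensive.

(** * Goursat's bisection for functions of squares *)

Section bisection.
Context {R : realType}.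
(** [L a c k] is a quantity attached to the square of side [k] with lower left
    corner [(a, c)], and is additive under cutting the square into quarters. *)
Variable L : R -> R -> R -> R.
Hypothesis LD : forall a c k : R, 0 < k ->
  L a c (k + k) = L a c k + L (a + k) c k + L a (c + k) k + L (a + k) (c + k) k.

(** The four quarters share [|L|], so one of them carries at least a fourth of
    it, which is its share of the area. *)
Lemma quarter_step (E a c k : R) : 0 < k -> E * k ^+ 2 <= `|L a c k| ->
  exists q : R * R,
    [/\ a <= q.1, q.1 + k / 2 <= a + k, c <= q.2, q.2 + k / 2 <= c + k &
     E * (k / 2) ^+ 2 <= `|L q.1 q.2 (k / 2)|].
Proof.
move=> k0 hE.
have k20 : 0 < k / 2 by lra.
have := LD a c k20; rewrite -[X in L a c X]splitr => hL.
have [h1|h1] := leP (E * (k / 2) ^+ 2) `|L a c (k / 2)|.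
  by exists (a, c); split => //=; lra.
have [h2|h2] := leP (E * (k / 2) ^+ 2) `|L (a + k / 2) c (k / 2)|.
  by exists (a + k / 2, c); split => //=; lra.
have [h3|h3] := leP (E * (k / 2) ^+ 2) `|L a (c + k / 2) (k / 2)|.
  by exists (a, c + k / 2); split => //=; lra.
have [h4|h4] := leP (E * (k / 2) ^+ 2) `|L (a + k / 2) (c + k / 2) (k / 2)|.
  by exists (a + k / 2, c + k / 2); split => //=; lra.
exfalso; move: hE; rewrite hL leNgt => /negP; apply.
have t1 := ler_normD (L a c (k / 2) + L (a + k / 2) c (k / 2) +
   L a (c + k / 2) (k / 2)) (L (a + k / 2) (c + k / 2) (k / 2)).
have t2 := ler_normD (L a c (k / 2) + L (a + k / 2) c (k / 2))
   (L a (c + k / 2) (k / 2)).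
have t3 := ler_normD (L a c (k / 2)) (L (a + k / 2) c (k / 2)).
have : E * k ^+ 2 = 4 * (E * (k / 2) ^+ 2) by field.
lra.
Qed.

Lemma half_expn_small (k d : R) : 0 < k -> 0 < d -> exists n : nat, k / 2 ^+ n < d.
Proof.
move=> k0 d0.
have [n hn] : exists n : nat, k / d < 2 ^+ n.
  have kd : 0 <= k / d by rewrite divr_ge0 // ltW.
  exists (Num.truncn (k / d)).+1.
  apply: (@lt_trans _ _ (Num.truncn (k / d)).+1%:R).
    exact: truncnS_gt.
  by rewrite -natrX ltr_nat ltn_expl.
exists n.
by rewrite ltr_pdivrMr ?exprn_gt0// mulrC -ltr_pdivrMr.
Qed.

(** Otherwise repeated quartering keeps [|L|] above a fixed multiple of the area
    along nested squares, against the smallness of [L] at their common point. *)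
Lemma bisection_zero (a c l : R) : 0 < l ->
  (forall x y : R, a <= x <= a + l -> c <= y <= c + l -> forall e : R, 0 < e ->
     exists2 d : R, 0 < d & forall a' c' k : R, 0 < k < d ->
       a' <= x <= a' + k -> c' <= y <= c' + k -> `|L a' c' k| <= e * k ^+ 2) ->
  L a c l = 0.
Proof.
move=> l0 hloc; apply/eqP/negPn/negP => Lneq0.
pose E := `|L a c l| / l ^+ 2.
have E0 : 0 < E by rewrite divr_gt0 ?normr_gt0 // exprn_gt0.
have k0 n : 0 < l / 2 ^+ n by rewrite divr_gt0 // exprn_gt0.
have kS n : l / 2 ^+ n.+1 = l / 2 ^+ n / 2.
  by rewrite exprSr invfM mulrA.
pose ok n (q : R * R) := E * (l / 2 ^+ n) ^+ 2 <= `|L q.1 q.2 (l / 2 ^+ n)|.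
pose sub n (q q' : R * R) := [/\ q.1 <= q'.1, q'.1 + l / 2 ^+ n.+1 <= q.1 + l / 2 ^+ n,
  q.2 <= q'.2 & q'.2 + l / 2 ^+ n.+1 <= q.2 + l / 2 ^+ n].
have stepP n q : exists q', ok n q -> ok n.+1 q' /\ sub n q q'.
  have [okq|] := boolP (ok n q); last by exists q.
  have [q' [h1 h2 h3 h4 h5]] := quarter_step (k0 n) okq.
  by exists q' => _; rewrite /ok /sub kS.
pose nxt n q := sval (cid (stepP n q)).
have nxtP n q : ok n q -> ok n.+1 (nxt n q) /\ sub n q (nxt n q).
  by rewrite /nxt; case: cid.
pose s := fix s n := if n is m.+1 then nxt m (s m) else (a, c).
have sok n : ok n (s n).
  elim: n => [|n /nxtP[]//].
  by rewrite /ok /= expr0 divr1 /E divfK // lt0r_neq0 // exprn_gt0.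
have ssub n : sub n (s n) (s n.+1) by case: (nxtP n _ (sok n)).
have mono1 n m : (n <= m)%N -> (s n).1 <= (s m).1.
  elim: m => [|m ih]; first by rewrite leqn0 => /eqP->.
  rewrite leq_eqVlt => /predU1P[->//|]; rewrite ltnS => /ih /le_trans; apply.
  by case: (ssub m).
have mono2 n m : (n <= m)%N -> (s m).1 + l / 2 ^+ m <= (s n).1 + l / 2 ^+ n.
  elim: m => [|m ih]; first by rewrite leqn0 => /eqP->.
  rewrite leq_eqVlt => /predU1P[->//|]; rewrite ltnS => /ih; apply: le_trans.
  by case: (ssub m).
have mono3 n m : (n <= m)%N -> (s n).2 <= (s m).2.
  elim: m => [|m ih]; first by rewrite leqn0 => /eqP->.
  rewrite leq_eqVlt => /predU1P[->//|]; rewrite ltnS => /ih /le_trans; apply.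
  by case: (ssub m).
have mono4 n m : (n <= m)%N -> (s m).2 + l / 2 ^+ m <= (s n).2 + l / 2 ^+ n.
  elim: m => [|m ih]; first by rewrite leqn0 => /eqP->.
  rewrite leq_eqVlt => /predU1P[->//|]; rewrite ltnS => /ih; apply: le_trans.
  by case: (ssub m).
have limP (u : nat -> R) : (forall n m, (n <= m)%N -> u n <= u m) ->
    (forall n m, (n <= m)%N -> u m + l / 2 ^+ m <= u n + l / 2 ^+ n) ->
    exists x, forall n, u n <= x <= u n + l / 2 ^+ n.
  move=> u1 u2.
  have ub n m : u m <= u n + l / 2 ^+ n.
    have [nm|mn] := leqP n m.
      by apply: le_trans (u2 _ _ nm); rewrite lerDl ltW.
    by apply: (le_trans (u1 _ _ (ltnW mn))); rewrite lerDl ltW.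
  exists (sup (range u)) => n; apply/andP; split.
    apply: ub_le_sup; last by exists n.
    by exists (u 0 + l / 2 ^+ 0) => _ [m _ <-].
  apply: ge_sup; first by exists (u n); exists n.
  by move=> _ [m _ <-].
have [x hx] := limP (fun n => (s n).1) mono1 mono2.
have [y hy] := limP (fun n => (s n).2) mono3 mono4.
have := hx 0%N; rewrite /= expr0 divr1 => hx0.
have := hy 0%N; rewrite /= expr0 divr1 => hy0.
have E20 : 0 < E / 2 by lra.
have [d d0 hd] := hloc x y hx0 hy0 _ E20.
have [n hn] := half_expn_small l0 d0.
have := hd (s n).1 (s n).2 (l / 2 ^+ n).
rewrite k0 hn => /(_ isT (hx n) (hy n)).
apply/negP; rewrite -ltNge; apply: lt_le_trans (sok n).
by rewrite ltr_pM2r ?exprn_gt0 //; lra.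
Qed.

(** This removes an exceptional point: of the sixteen subsquares obtained by
    quartering twice a square centred at the point, only the four central ones
    contain it, and they make up the centred square of half the size.  So [L] is
    the same for all centred squares, and tends to zero with them. *)
Lemma centered_zero (x0 y0 l C : R) : 0 < l ->
  (forall a c k : R, 0 < k ->
     ~~ ((a <= x0 <= a + k) && (c <= y0 <= c + k)) -> L a c k = 0) ->
  (forall k : R, 0 < k <= l -> `|L (x0 - k) (y0 - k) (k + k)| <= C * k) ->
  L (x0 - l) (y0 - l) (l + l) = 0.
Proof.
move=> l0 hzero hsmall.
(* the square of half-side [k = m + m] is cut into sixteen squares of side [m] *)
have shrink k : 0 < k -> L (x0 - k) (y0 - k) (k + k) =
    L (x0 - k / 2) (y0 - k / 2) (k / 2 + k / 2).
  move=> k0.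
  pose m := k / 2; have m0 : 0 < m by rewrite /m; lra.
  have -> : k = m + m by rewrite /m -splitr.
  rewrite [(m + m) / 2](_ : _ = m); last by lra.
  rewrite !LD; try by lra.
  rewrite !opprD !addrA.
  rewrite !(subrK).
  have nz a c : (x0 < a) || (a + m < x0) || (y0 < c) || (c + m < y0) -> L a c m = 0.
    move=> h; apply: hzero => //; apply/negP => /andP[/andP[h1 h2] /andP[h3 h4]].
    by move: h => /orP[/orP[/orP[]|]|]; lra.
  do ?[rewrite (nz (x0 - m - m)); last by apply/orP; left; apply/orP; left; lra].
  do ?[rewrite (nz (x0 + m)); last by apply/orP; left; apply/orP; left; lra].
  do ?[rewrite (nz _ (y0 - m - m)); last by apply/orP; right; lra].
  do ?[rewrite (nz _ (y0 + m)); last by apply/orP; left; apply/orP; right; lra].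
  lra.
have iter n : L (x0 - l) (y0 - l) (l + l) =
    L (x0 - l / 2 ^+ n) (y0 - l / 2 ^+ n) (l / 2 ^+ n + l / 2 ^+ n).
  elim: n => [|n ->]; first by rewrite expr0 divr1.
  rewrite shrink; last by rewrite divr_gt0 // exprn_gt0.
  by rewrite exprSr invfM mulrA.
apply/eqP/negPn/negP => Lneq0.
have L0 : 0 < `|L (x0 - l) (y0 - l) (l + l)| by rewrite normr_gt0.
have C0 : 0 <= C.
  have := hsmall l; rewrite l0 lexx => /(_ isT) h.
  by rewrite -(pmulr_lge0 _ l0); apply: le_trans h.
have d0 : 0 < `|L (x0 - l) (y0 - l) (l + l)| / (C + 1) by rewrite divr_gt0 //; lra.
have [n hn] := half_expn_small l0 d0.
have kn0 : 0 < l / 2 ^+ n by rewrite divr_gt0 // exprn_gt0.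
have knl : l / 2 ^+ n <= l.
  by rewrite ler_pdivrMr ?exprn_gt0// ler_peMr ?(ltW l0)// exprn_ege1 // ler1n.
have := hsmall (l / 2 ^+ n); rewrite kn0 knl => /(_ isT).
rewrite -iter; move: hn; rewrite ltr_pdivlMr; last by lra.
nra.
Qed.

End bisection.

(** * Integrals over squares and their edges *)

Section plane.
Context {R : realType}.

Definition lebesgue_plane :
    {measure set (measurableTypeR R * measurableTypeR R) -> \bar R} :=
  (@lebesgue_measure R \x @lebesgue_measure R)%E.

(** The product sigma-algebra contains the rational boxes, and an open set is the
    union of the countably many rational boxes inside it. *)
Lemma plane_open_measurable (A : set (R * R)) : open A ->
  measurable (A : set (measurableTypeR R * measurableTypeR R)).
Proof.
move=> oA.
pose box (q : (rat * rat) * (rat * rat)) : set (R * R) :=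
  `](ratr q.1.1 : R), ratr q.1.2[%classic `*` `](ratr q.2.1 : R), ratr q.2.2[%classic.
have -> : A = \bigcup_q (if `[<box q `<=` A>] then box q else set0).
  apply/seteqP; split => [[x y] Axy|[x y] [q _]]; last first.
    by case: ifPn => [/asboolP h /h|].
  have := oA _ Axy; rewrite -nbhs_ballE => -[e /= e0 he].
  have [] := @rat_in_itvoo R (x - e) x; first by rewrite ltrBlDr ltrDl.
  move=> q1; rewrite in_itv /= => /andP[q11 q12].
  have [] := @rat_in_itvoo R x (x + e); first by rewrite ltrDl.
  move=> q2; rewrite in_itv /= => /andP[q21 q22].
  have [] := @rat_in_itvoo R (y - e) y; first by rewrite ltrBlDr ltrDl.
  move=> q3; rewrite in_itv /= => /andP[q31 q32].
  have [] := @rat_in_itvoo R y (y + e); first by rewrite ltrDl.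
  move=> q4; rewrite in_itv /= => /andP[q41 q42].
  exists ((q1, q2), (q3, q4)) => //.
  rewrite /= ifT; first by split; rewrite /= in_itv /= ?q12 ?q21 ?q32 ?q41.
  apply/asboolP => -[u v]; rewrite /box /= !in_itv /= => -[/andP[h1 h2] /andP[h3 h4]].
  apply: he; split => /=; rewrite /ball /= ltr_norml; apply/andP; split; lra.
apply: countable_bigcupT_measurable => [|q]; first exact: countableP.
case: ifP => // _.
by apply: measurableX; exact: measurable_itv.
Qed.

Lemma plane_continuous_measurable (D : set (R * R)) (f : R * R -> R) : open D ->
  (forall p, D p -> {for p, continuous f}) ->
  measurable_fun (D : set (measurableTypeR R * measurableTypeR R)) f.
Proof.
move=> oD cf; apply: (measurability _ (measurable_realfun.RGenOpens.measurableE R)).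
move=> _ [_ [a [b ->] <-]]; apply: plane_open_measurable.
rewrite openE => p [Dp abp].
have h : nbhs p (f @^-1` `]a, b[%classic).
  by apply: (cf _ Dp); exact: (interval_open).
by apply: filterI h; exact: oD.
Qed.

Lemma plane_continuous_measurableT (f : R * R -> R) : continuous f ->
  measurable_fun (setT : set (measurableTypeR R * measurableTypeR R)) f.
Proof.
move=> cf; apply: (@plane_continuous_measurable setT) => [|p _]; last exact: cf.
exact: (@openT (R * R)%type).
Qed.

(** Half-open, so that the four quarters of a square are disjoint. *)
Definition box (a c l : R) : set (measurableTypeR R * measurableTypeR R) :=
  `]a, a + l]%classic `*` `]c, c + l]%classic.

Lemma measurable_box a c l : measurable (box a c l).
Proof. by apply: measurableX; exact: measurable_itv. Qed.

Lemma box_measure (a c l : R) : 0 < l -> lebesgue_plane (box a c l) = (l ^+ 2)%:E.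
Proof.
move=> l0; have -> : lebesgue_plane (box a c l) = (lebesgue_measure (`]a, (a + l)%R]%classic : set R) *
    lebesgue_measure (`]c, (c + l)%R]%classic : set R))%E.
  by apply: product_measure1E; exact: measurable_itv.
by rewrite !lebesgue_measure_itv /= !lte_fin !ltrDl l0 -!EFinD -EFinM; congr EFin; ring.
Qed.

Lemma edge_measure (a l : R) : 0 < l ->
  lebesgue_measure (`]a, a + l]%classic : set (measurableTypeR R)) = l%:E.
Proof.
by move=> l0; rewrite lebesgue_measure_itv /= !lte_fin !ltrDl l0 -!EFinD; congr EFin; ring.
Qed.

Lemma box_integrable (f : R * R -> R) a c l : continuous f ->
  lebesgue_plane.-integrable (box a c l) (EFin \o f).
Proof.
move=> cf; have [l0|l0] := ltP 0 l; last first.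
  rewrite (_ : box a c l = set0); first exact: integrable_set0.
  apply/seteqP; split=> // -[x y] [/=]; rewrite !in_itv /=; lra.
apply: measurable_bounded_integrable.
- exact: measurable_box.
- by rewrite box_measure // ltry.
- apply: measurable_funS (plane_continuous_measurableT cf) => //.
have : compact (`[a, a + l]%classic `*` `[c, c + l]%classic : set (R * R)).
  by apply: compact_setX; exact: segment_compact.
have cs : {within (`[a, a + l]%classic `*` `[c, c + l]%classic : set (R * R)), continuous f}.
  by apply: continuous_subspaceT.
move=> /(continuous_compact cs) /compact_bounded [M [Mr hM]].
exists M; split => // y My p bp /=; apply: hM => //; exists p => //.
case: bp; rewrite /= !in_itv /= => /andP[h1 h2] /andP[h3 h4]; rewrite h2 h4 !ltW //.
Qed.

Lemma edge_integrable (f : R -> R) a l : continuous f ->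
  lebesgue_measure.-integrable (`]a, a + l]%classic : set (measurableTypeR R)) (EFin \o f).
Proof.
move=> cf.
have h : lebesgue_measure.-integrable (`[a, a + l]%classic : set (measurableTypeR R)) (EFin \o f).
  apply: continuous_compact_integrable; first exact: segment_compact.
  by apply: continuous_subspaceT.
apply: integrableS h => //.
by apply: subset_itvr; rewrite bnd_simp.
Qed.

Definition edge_int (f : R -> R) a l : R := \int[lebesgue_measure]_(x in `]a, a + l]) f x.
Definition box_int (f : R * R -> R) a c l : R := \int[lebesgue_plane]_(p in box a c l) f p.

Lemma edge_intD (f : R -> R) a k : continuous f -> 0 < k ->
  edge_int f a (k + k) = edge_int f a k + edge_int f (a + k) k.
Proof.
move=> cf k0; rewrite /edge_int.
have E : `]a, a + (k + k)]%classic = `]a, a + k]%classic `|` `](a + k), a + k + k]%classic.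
  apply/seteqP; split=> x /=; rewrite !in_itv /=.
    move=> h; have [h1|h1] := leP x (a + k); [left|right]; lra.
  by case; lra.
rewrite E Rintegral_setU //.
- by rewrite -E; exact: edge_integrable.
- by apply/disj_set2P/seteqP; split=> x //= [] /=; rewrite !in_itv /=; lra.
Qed.

Lemma box_intD (f : R * R -> R) a c k : continuous f -> 0 < k ->
  box_int f a c (k + k) = box_int f a c k + box_int f (a + k) c k +
    box_int f a (c + k) k + box_int f (a + k) (c + k) k.
Proof.
move=> cf k0; rewrite /box_int.
have E : box a c (k + k) = (box a c k `|` box (a + k) c k) `|`
   (box a (c + k) k `|` box (a + k) (c + k) k).
  apply/seteqP; split=> -[x y] /=; rewrite /box /= !in_itv /=.
    move=> h; have [h1|h1] := leP x (a + k); have [h2|h2] := leP y (c + k).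
    - by left; left; lra.
    - by right; left; lra.
    - by left; right; lra.
    - by right; right; lra.
  by move=> [[]|[]]; lra.
have I1 := box_integrable a c (k + k) cf.
have mb := measurable_box.
have mU p q r s : measurable (box p q k `|` box r s k) by apply: measurableU.
rewrite E Rintegral_setU //.
- rewrite Rintegral_setU //; first rewrite Rintegral_setU // ?addrA//.
  + apply: integrableS I1 => //.
    by rewrite E; apply: subsetUr.
  + by apply/disj_set2P/seteqP; split=> -[x y] //= [] /=; rewrite /box /= !in_itv /=; lra.
  + apply: integrableS I1 => //.
    by rewrite E; apply: subsetUl.
  + by apply/disj_set2P/seteqP; split=> -[x y] //= [] /=; rewrite /box /= !in_itv /=; lra.
- by rewrite -E.
- apply/disj_set2P/seteqP; split=> -[x y] //= []; rewrite /box /= !in_itv /=.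
  by move=> [|] h1 [|]; lra.
Qed.

Lemma Rintegral_near_cst d (T : measurableType d) (mu : {measure set T -> \bar R})
    (D : set T) (f : T -> R) (v e m : R) :
  measurable D -> mu D = m%:E -> mu.-integrable D (EFin \o f) ->
  (forall x, D x -> `|f x - v| <= e) ->
  `|\int[mu]_(x in D) f x - v * m| <= e * m.
Proof.
move=> mD mum If fe.
have Ic (r : R) : mu.-integrable D (EFin \o cst r).
  apply: measurable_bounded_integrable => //; first by rewrite mum ltry.
  by exists `|r|; split; [exact: num_real|move=> y yr x _; exact: ltW].
have int_cst (r : R) : \int[mu]_(x in D) r = r * m by rewrite Rintegral_cst // mum.
rewrite -int_cst -RintegralB //; last exact: (Ic v).
have If2 : mu.-integrable D (EFin \o (fun x => f x - v)).
  have -> : EFin \o (fun x => f x - v) = ((EFin \o f) \- (EFin \o cst v))%E by apply/funext.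
  exact: integrableB (Ic v).
apply: le_trans (le_normr_Rintegral _ _) _ => //.
rewrite -int_cst; apply: le_Rintegral => //.
- have -> : EFin \o (fun x => `|f x - v|) = abse \o (EFin \o (fun x => f x - v)) by apply/funext.
  exact: integrable_abse.
- exact: Ic.
Qed.

End plane.

(** * A divergence theorem for merely differentiable fields *)

Section divergence.
Context {R : realType}.
Implicit Types (f g P Q h : R * R -> R).

(** Differentiability at the single point [p], with partial derivatives [A] and
    [B]. *)
Definition lin_approx f (p : R * R) (A B : R) := forall e : R, 0 < e ->
  exists2 d : R, 0 < d & forall x y : R, `|x - p.1| < d -> `|y - p.2| < d ->
    `|f (x, y) - f p - A * (x - p.1) - B * (y - p.2)| <= e * (`|x - p.1| + `|y - p.2|).

Lemma lin_approxM f g p A B A' B' : lin_approx f p A B -> lin_approx g p A' B' ->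
  lin_approx (fun q => f q * g q) p (A * g p + f p * A') (B * g p + f p * B').
Proof.
move=> hf hg e e0.
have nA := normr_ge0 A; have nB := normr_ge0 B.
have nA' := normr_ge0 A'; have nB' := normr_ge0 B'.
have nf := normr_ge0 (f p); have ng := normr_ge0 (g p).
have [K [K1 Kf Kg KAB KAB']] : exists K, [/\ 1 <= K, `|f p| <= K, `|g p| <= K,
    `|A| + `|B| + 1 <= K & `|A'| + `|B'| + 1 <= K].
  by exists (1 + `|A| + `|B| + `|A'| + `|B'| + `|f p| + `|g p|); split; lra.
clear nA nB nA' nB' nf ng.
have K0 : 0 < K by lra.
have e10 : 0 < Num.min 1 (e / (4 * K)) by rewrite lt_min ltr01 divr_gt0 // mulr_gt0.
have [d1 d10 h1] := hf _ e10; have [d2 d20 h2] := hg _ e10.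
pose d3 := e / (4 * K ^+ 2).
have d30 : 0 < d3 by rewrite divr_gt0 // mulr_gt0 // exprn_gt0.
exists (Num.min d3 (Num.min d1 d2)); first by rewrite !lt_min d10 d20 d30.
move=> x y; rewrite !lt_min => /and3P[hx3 hx1 hx2] /and3P[hy3 hy1 hy2].
have := h1 x y hx1 hy1; have := h2 x y hx2 hy2.
clear h1 h2 hx1 hx2 hy1 hy2 d10 d20.
set dx := x - p.1 in hx3 *; set dy := y - p.2 in hy3 *; set s := `|dx| + `|dy|.
set rf := f (x, y) - _ - _ - _; set rg := g (x, y) - _ - _ - _.
have s0 : 0 <= s by rewrite addr_ge0.
have ss : s <= 2 * d3 by rewrite /s; lra.
move: e10; set e1 := Num.min _ _ => e10 hrg hrf.
have e11 : e1 <= 1 by rewrite ge_min lexx.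
have e12 : e1 * (4 * K) <= e.
  by rewrite -ler_pdivlMr; [rewrite ge_min lexx orbT|rewrite mulr_gt0].
have -> : f (x, y) * g (x, y) - f p * g p - (A * g p + f p * A') * dx - (B * g p + f p * B') * dy
  = f p * rg + g p * rf + (A * dx + B * dy + rf) * (A' * dx + B' * dy + rg).
  by rewrite /rf /rg; ring.
have b1 : `|f p * rg| <= K * (e1 * s) by rewrite normrM ler_pM.
have b2 : `|g p * rf| <= K * (e1 * s) by rewrite normrM ler_pM.
have e1s : e1 * s <= s by rewrite ler_piMl.
have lin a b r : `|a| + `|b| + 1 <= K -> `|r| <= e1 * s -> `|a * dx + b * dy + r| <= K * s.
  move=> hK hr; apply: (@le_trans _ _ ((`|a| + `|b| + 1) * s)); last by rewrite ler_wpM2r.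
  rewrite !mulrDl mul1r; apply: le_trans (ler_normD _ _) _.
  apply: lerD; last exact: le_trans hr e1s.
  apply: le_trans (ler_normD _ _) _; rewrite !normrM.
  by apply: lerD; rewrite ler_wpM2l // /s ?lerDl ?lerDr.
have b3 : `|(A * dx + B * dy + rf) * (A' * dx + B' * dy + rg)| <= K * s * (K * s).
  by rewrite normrM ler_pM // lin.
have b4 : K * s * (K * s) <= e / 2 * s.
  rewrite mulrA ler_wpM2r //.
  apply: (@le_trans _ _ (K * (2 * d3) * K)).
    by rewrite ler_wpM2r ?ler_wpM2l // ltW.
  by rewrite le_eqVlt; apply/orP; left; apply/eqP; rewrite /d3; field; rewrite gt_eqF.
have b5 : K * (e1 * s) <= e / 4 * s.
  rewrite mulrA ler_wpM2r // ler_pdivlMr //.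
  by rewrite mulrAC mulrC [K * 4]mulrC.
apply: le_trans (ler_normD _ _) _.
have b6 := ler_normD (f p * rg) (g p * rf).
clear - b1 b2 b3 b4 b5 b6; lra.
Qed.

Lemma edge_intB (f g : R -> R) a l : continuous f -> continuous g ->
  edge_int f a l - edge_int g a l = edge_int (fun x => f x - g x) a l.
Proof. by move=> cf cg; rewrite /edge_int RintegralB //; exact: edge_integrable. Qed.

Lemma edge_int_near (f : R -> R) a l (v e : R) : 0 < l -> continuous f ->
  (forall x, a <= x <= a + l -> `|f x - v| <= e) -> `|edge_int f a l - v * l| <= e * l.
Proof.
move=> l0 cf h; apply: Rintegral_near_cst => //.
- exact: edge_measure.
- exact: edge_integrable.
- by move=> x /=; rewrite in_itv /= => /andP[h1 h2]; apply: h; rewrite h2 ltW.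
Qed.

Lemma box_int_near f a c l (v e : R) : 0 < l -> continuous f ->
  (forall x y, a <= x <= a + l -> c <= y <= c + l -> `|f (x, y) - v| <= e) ->
  `|box_int f a c l - v * l ^+ 2| <= e * l ^+ 2.
Proof.
move=> l0 cf h; apply: Rintegral_near_cst => //.
- exact: measurable_box.
- exact: box_measure.
- exact: box_integrable.
- move=> [x y]; rewrite /box /= !in_itv /= => -[/andP[h1 h2] /andP[h3 h4]].
  by apply: h; rewrite ?h2 ?h4 ?(ltW h1) ?(ltW h3).
Qed.

Lemma slice_y f a : continuous f -> continuous (fun y : R => f (a, y)).
Proof.
move=> cf y; apply: (@continuous_comp _ _ _ (fun y : R => (a, y)) f); last exact: cf.
exact: (@cvg_pair _ _ _ (nbhs y) (nbhs a) (nbhs y) _ _ _ (fun=> a) id (cvg_cst _) cvg_id).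
Qed.

Lemma slice_x f c : continuous f -> continuous (fun x : R => f (x, c)).
Proof.
move=> cf x; apply: (@continuous_comp _ _ _ (fun x : R => (x, c)) f); last exact: cf.
exact: (@cvg_pair _ _ _ (nbhs x) (nbhs x) (nbhs c) _ _ _ id (fun=> c) cvg_id (cvg_cst _)).
Qed.

Section defect.
Variables P Q h : R * R -> R.
Hypotheses (cP : continuous P) (cQ : continuous Q) (ch : continuous h).

(** The flux of the field [(P, Q)] through the boundary of a square minus the
    integral of its would-be divergence [h]. *)
Definition defect a c k : R :=
  edge_int (fun y => P (a + k, y)) c k - edge_int (fun y => P (a, y)) c k +
  (edge_int (fun x => Q (x, c + k)) a k - edge_int (fun x => Q (x, c)) a k) -
  box_int h a c k.

Lemma defectD (a c k : R) : 0 < k -> defect a c (k + k) =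
  defect a c k + defect (a + k) c k + defect a (c + k) k + defect (a + k) (c + k) k.
Proof.
move=> k0; rewrite /defect box_intD //.
rewrite !(edge_intD _ (@slice_y _ _ cP) k0) !(edge_intD _ (@slice_x _ _ cQ) k0) !addrA.
ring.
Qed.

(** The defect is exactly zero for an affine field with constant divergence;
    replacing the field by its linear approximation costs [o(k)] on each edge of
    length [k]. *)
Lemma defect_near (A B C E x y : R) : lin_approx P (x, y) A B -> lin_approx Q (x, y) C E ->
  h (x, y) = A + E -> forall e : R, 0 < e ->
  exists2 d : R, 0 < d & forall a c k : R, 0 < k < d ->
    a <= x <= a + k -> c <= y <= c + k -> `|defect a c k| <= e * k ^+ 2.
Proof.
move=> hP hQ hh e e0; have e90 : 0 < e / 9 by lra.
have [d1 d10 h1] := hP _ e90; have [d2 d20 h2] := hQ _ e90.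
have : \forall q \near (x, y), `|h (x, y) - h q| < e / 9.
  by have /cvgr_dist_lt := @ch (x, y); apply.
move=> /nbhs_ballP [d3 /= d30 h3].
exists (Num.min d3 (Num.min d1 d2)); first by rewrite !lt_min d10 d20 d30.
move=> a c k; rewrite !lt_min => /andP[k0 /and3P[k3 k1 k2]] hx hy.
have near u v d : k < d -> a <= u <= a + k -> c <= v <= c + k ->
    `|u - x| < d /\ `|v - y| < d.
  by move=> kd hu hv; split; rewrite ltr_norml; lra.
have near2 u v : a <= u <= a + k -> c <= v <= c + k -> `|u - x| + `|v - y| <= 2 * k.
  move=> hu hv; have : `|u - x| <= k by rewrite ler_norml; lra.
  have : `|v - y| <= k by rewrite ler_norml; lra.
  lra.
have ina : a <= a <= a + k by lra. have inak : a <= a + k <= a + k by lra.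
have inc : c <= c <= c + k by lra. have inck : c <= c + k <= c + k by lra.
have bP u v : a <= u <= a + k -> c <= v <= c + k ->
    `|P (u, v) - P (x, y) - A * (u - x) - B * (v - y)| <= e / 9 * (2 * k).
  move=> hu hv; have [g1 g2] := near u v _ k1 hu hv.
  by apply: le_trans (h1 _ _ g1 g2) _; rewrite ler_wpM2l ?near2 // ltW.
have bQ u v : a <= u <= a + k -> c <= v <= c + k ->
    `|Q (u, v) - Q (x, y) - C * (u - x) - E * (v - y)| <= e / 9 * (2 * k).
  move=> hu hv; have [g1 g2] := near u v _ k2 hu hv.
  by apply: le_trans (h2 _ _ g1 g2) _; rewrite ler_wpM2l ?near2 // ltW.
have IP : `|edge_int (fun y => P (a + k, y)) c k - edge_int (fun y => P (a, y)) c k - A * k * k|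
    <= e / 9 * (4 * k) * k.
  rewrite edge_intB; try exact: slice_y.
  apply: edge_int_near => //; first by move=> v; apply: cvgB; exact: slice_y.
  move=> v hv; have := bP (a + k) v inak hv; have := bP a v ina hv.
  by rewrite !ler_norml; lra.
have IQ : `|edge_int (fun x => Q (x, c + k)) a k - edge_int (fun x => Q (x, c)) a k - E * k * k|
    <= e / 9 * (4 * k) * k.
  rewrite edge_intB; try exact: slice_x.
  apply: edge_int_near => //; first by move=> v; apply: cvgB; exact: slice_x.
  move=> v hv; have := bQ v (c + k) hv inck; have := bQ v c hv inc.
  by rewrite !ler_norml; lra.
have Ih : `|box_int h a c k - (A + E) * k ^+ 2| <= e / 9 * k ^+ 2.
  apply: box_int_near => // u v hu hv; rewrite -hh distrC ltW //; apply: h3.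
  by split; rewrite /ball /= distrC; have [] := near u v _ k3 hu hv.
rewrite /defect; move: IP IQ Ih; rewrite !ler_norml; lra.
Qed.

Lemma defect_bound (M a c k : R) : 0 < k -> (forall p, `|P p| <= M) ->
  (forall p, `|Q p| <= M) -> (forall p, `|h p| <= M) -> `|defect a c k| <= M * (4 * k + k ^+ 2).
Proof.
move=> k0 bP bQ bh.
have eb (f : R -> R) u : continuous f -> (forall x, `|f x| <= M) -> `|edge_int f u k| <= M * k.
  move=> cf bf; have := @edge_int_near f u k 0 M k0 cf; rewrite mul0r subr0; apply => x _.
  by rewrite subr0.
have := eb _ c (@slice_y _ (a + k) cP) (fun _ => bP _).
have := eb _ c (@slice_y _ a cP) (fun _ => bP _).
have := eb _ a (@slice_x _ (c + k) cQ) (fun _ => bQ _).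
have := eb _ a (@slice_x _ c cQ) (fun _ => bQ _).
have : `|box_int h a c k| <= M * k ^+ 2.
  have := @box_int_near h a c k 0 M k0 ch; rewrite mul0r subr0; apply => x y _ _.
  by rewrite subr0.
rewrite /defect !ler_norml; lra.
Qed.

End defect.

(** The partial derivatives need not be continuous, only their sum [h] is, so the
    fundamental theorem of calculus does not apply on lines; bisection does.  One
    point is exempted, because the difference quotient of a holomorphic function
    is only known to be continuous at its centre. *)
Theorem divergence_compact_support P Q h (x0 y0 l M : R) : 0 < l ->
  continuous P -> continuous Q -> continuous h ->
  (forall p, `|P p| <= M) -> (forall p, `|Q p| <= M) -> (forall p, `|h p| <= M) ->
  (forall p, p <> (x0, y0) -> exists A B C E, [/\ lin_approx P p A B,
     lin_approx Q p C E & h p = A + E]) ->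
  (forall x y, (l <= `|x - x0|) || (l <= `|y - y0|) -> P (x, y) = 0 /\ Q (x, y) = 0) ->
  box_int h (x0 - l) (y0 - l) (l + l) = 0.
Proof.
move=> l0 cP cQ ch bP bQ bh hloc hsupp.
have M0 : 0 <= M by apply: le_trans (bP (0, 0)).
have dD := defectD cP cQ ch.
have hz (a c k : R) : 0 < k -> ~~ ((a <= x0 <= a + k) && (c <= y0 <= c + k)) ->
    defect P Q h a c k = 0.
  move=> k0 hn; apply: (bisection_zero dD) => // x y hx hy.
  have [|A [B [C [E [hP hQ hh]]]]] := hloc (x, y).
    by case=> ? ?; subst x y; rewrite hx hy in hn.
  exact: (defect_near cP cQ ch hP hQ hh).
have : defect P Q h (x0 - l) (y0 - l) (l + l) = 0.
  apply: (@centered_zero _ _ dD x0 y0 l (M * (8 + 4 * l)) l0 hz) => k /andP[k0 kl].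
  apply: le_trans (defect_bound cP cQ ch (x0 - k) (y0 - k) _ bP bQ bh) _; first by lra.
  by rewrite -mulrA ler_wpM2l //; nra.
rewrite /defect.
have -> : x0 - l + (l + l) = x0 + l by ring.
have -> : y0 - l + (l + l) = y0 + l by ring.
have e0 (f : R -> R) u k : (forall x, f x = 0) -> edge_int f u k = 0.
  move=> f0; rewrite /edge_int (_ : f = cst 0); last by apply/funext.
  by rewrite Rintegral_cst // mul0r.
have n1 : `|x0 + l - x0| = l by rewrite addrAC subrr add0r gtr0_norm.
have n2 : `|x0 - l - x0| = l by rewrite addrAC subrr add0r normrN gtr0_norm.
have n3 : `|y0 + l - y0| = l by rewrite addrAC subrr add0r gtr0_norm.
have n4 : `|y0 - l - y0| = l by rewrite addrAC subrr add0r normrN gtr0_norm.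
do 4 (rewrite e0; last by move=> x; apply hsupp; rewrite ?n1 ?n2 ?n3 ?n4 lexx ?orbT).
by rewrite subrr add0r sub0r => /eqP; rewrite oppr_eq0 => /eqP.
Qed.

End divergence.

(** * Modulus and complex derivative in real terms *)

Section cmod.
Context {R : realType}.
Implicit Types z w : R[i].

Lemma norm_cmod z : `|z| = (cmod z)%:C.
Proof. by rewrite normc_def /cmod; case: z. Qed.

Lemma cmodE z : cmod z = Num.sqrt (complex.Re z ^+ 2 + complex.Im z ^+ 2).
Proof. by case: z. Qed.

Lemma cmod_sqr z : cmod z ^+ 2 = complex.Re z ^+ 2 + complex.Im z ^+ 2.
Proof. by rewrite cmodE sqr_sqrtr // addr_ge0 // sqr_ge0. Qed.

Lemma cmod_ge0 z : 0 <= cmod z.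
Proof. by rewrite cmodE sqrtr_ge0. Qed.

Lemma cmod0 : cmod (0 : R[i]) = 0.
Proof. exact: ComplexField.Normc.normc0. Qed.

Lemma cmod1 : cmod (1 : R[i]) = 1.
Proof. exact: ComplexField.Normc.normc1. Qed.

Lemma cmod_eq0 z : (cmod z == 0) = (z == 0).
Proof.
apply/eqP/eqP => [|->]; last exact: cmod0.
exact: ComplexField.Normc.eq0_normc.
Qed.

Lemma cmod_gt0 z : (0 < cmod z) = (z != 0).
Proof. by rewrite lt_neqAle cmod_ge0 andbT eq_sym cmod_eq0. Qed.

Lemma cmodM z w : cmod (z * w) = cmod z * cmod w.
Proof. exact: ComplexField.Normc.normcM. Qed.

Lemma cmodV z : cmod z^-1 = (cmod z)^-1.
Proof. exact: ComplexField.Normc.normcV. Qed.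

Lemma cmodX z n : cmod (z ^+ n) = cmod z ^+ n.
Proof. by elim: n => [|n ih]; rewrite ?expr0 ?cmod1 // !exprS cmodM ih. Qed.

Lemma cmodN z : cmod (- z) = cmod z.
Proof. by case: z => x y; rewrite !cmodE /= !sqrrN. Qed.

Lemma cmodB z w : cmod (z - w) = cmod (w - z).
Proof. by rewrite -opprB cmodN. Qed.

Lemma ler_cmodD z w : cmod (z + w) <= cmod z + cmod w.
Proof. by rewrite -lecR rmorphD /= -!norm_cmod; exact: ler_normD. Qed.

Lemma cmod_real (x : R) : cmod x%:C = `|x|.
Proof. by rewrite cmodE /= expr0n /= addr0 sqrtr_sqr. Qed.

Lemma ler_cmod_Re z : `|complex.Re z| <= cmod z.
Proof. by rewrite cmodE -sqrtr_sqr ler_sqrt ?lerDl ?sqr_ge0 // addr_ge0 // sqr_ge0. Qed.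

Lemma ler_cmod_Im z : `|complex.Im z| <= cmod z.
Proof. by rewrite cmodE -sqrtr_sqr ler_sqrt ?lerDr ?sqr_ge0 // addr_ge0 // sqr_ge0. Qed.

Lemma ler_cmod_sum z : cmod z <= `|complex.Re z| + `|complex.Im z|.
Proof.
rewrite -(@ler_pXn2r _ 2) ?nnegrE ?cmod_ge0 ?addr_ge0 // cmod_sqr.
rewrite -(real_normK (num_real (complex.Re z))) -(real_normK (num_real (complex.Im z))).
have := normr_ge0 (complex.Re z); have := normr_ge0 (complex.Im z); nra.
Qed.

Lemma unit_diskP z : unit_disk z <-> cmod z < 1.
Proof. by rewrite /unit_disk /= norm_cmod ltcE /= eqxx. Qed.

End cmod.

Section cdiff.
Context {R : realType}.
Implicit Types (G : R[i] -> R[i]) (z : R[i]).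

(** Complex differentiability with real-valued errors: the norm of [R[i]] takes
    its values in [R[i]]. *)
Definition cdiff G z (g : R[i]) := forall e : R, 0 < e ->
  exists2 d : R, 0 < d & forall h : R[i], cmod h < d ->
    cmod (G (z + h) - G z - g * h) <= e * cmod h.

Lemma nbhs_cmodP (z : R[i]^o) (P : set R[i]) :
  nbhs z P <-> exists2 d : R, 0 < d & forall w, cmod (w - z) < d -> P w.
Proof.
split=> [/nbhs_ballP[d /= d0 h]|[d d0 h]].
  have dE : d = (complex.Re d)%:C.
    by move: d0; rewrite ltcE => /andP[/eqP di _]; case: d di {h} => x y /= ->.
  exists (complex.Re d); first by move: d0; rewrite ltcE => /andP[].
  move=> w hw; apply: h; rewrite /ball /= dE norm_cmod ltcE /= eqxx /=.
  by rewrite cmodB.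
apply/nbhs_ballP; exists (d%:C); first by rewrite /= ltcE /= eqxx d0.
by move=> w; rewrite /ball /= norm_cmod ltcE /= eqxx /= cmodB; exact: h.
Qed.

Lemma derivable_cdiff G z : derivable (G : R[i]^o -> R[i]^o) z 1 ->
  exists g, cdiff G z g.
Proof.
move=> /derivable_nbhs; set g := (derive _ _ _) => hG; exists g => e e0.
have e0' : (0 : R[i]) < e%:C by rewrite ltcE /= eqxx.
have /eqaddoP /(_ _ e0') := hG.
move=> /nbhs_cmodP[d d0 h]; exists d => // w wd.
have := h w; rewrite subr0 => /(_ wd) /=.
rewrite !norm_cmod -rmorphM lecE /= eqxx /=.
rewrite /cst /= !opprD !fctE /=.
by rewrite /GRing.scale /= mulr1 (addrC w) addrA (mulrC w).
Qed.

Lemma derivable_expn (q : R[i] -> R[i]) z n : derivable (q : R[i]^o -> R[i]^o) z 1 ->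
  derivable ((fun y => q y ^+ n) : R[i]^o -> R[i]^o) z 1.
Proof.
move=> dq; elim: n => [|n ih].
  by rewrite (_ : (fun z => _) = cst 1); [exact: derivable_cst|apply/funext => y; rewrite expr0].
rewrite (_ : (fun y => _) = q * (fun y => q y ^+ n)); last first.
  by apply/funext => y; rewrite exprS.
exact: (derivableM dq ih).
Qed.

End cdiff.

Section slices.
Context {R : realType}.
Implicit Types (G : R[i] -> R[i]) (z : R[i]).
Local Notation pc := (@pair_to_complex R).

Lemma ReB (z w : R[i]) : complex.Re (z - w) = complex.Re z - complex.Re w.
Proof. by case: z; case: w. Qed.
Lemma ImB (z w : R[i]) : complex.Im (z - w) = complex.Im z - complex.Im w.
Proof. by case: z; case: w. Qed.
Lemma ReM (z w : R[i]) : complex.Re (z * w) =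
  complex.Re z * complex.Re w - complex.Im z * complex.Im w.
Proof. by case: z; case: w. Qed.
Lemma ImM (z w : R[i]) : complex.Im (z * w) =
  complex.Re z * complex.Im w + complex.Im z * complex.Re w.
Proof. by case: z; case: w. Qed.

(** The coefficients express the Cauchy-Riemann equations. *)
Lemma cdiff_lin_approx G (p : R * R) (g : R[i]) : cdiff G (pc p) g ->
  lin_approx (fun q => complex.Re (G (pc q))) p (complex.Re g) (- complex.Im g) /\
  lin_approx (fun q => complex.Im (G (pc q))) p (complex.Im g) (complex.Re g).
Proof.
move=> hG.
have key (e : R) : 0 < e -> exists2 d : R, 0 < d & forall x y : R, `|x - p.1| < d ->
   `|y - p.2| < d -> cmod (G (pc (x, y)) - G (pc p) - g * (pc (x, y) - pc p)) <=
     e * (`|x - p.1| + `|y - p.2|).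
  move=> e0; have [d d0 h] := hG _ e0.
  exists (d / 2); first by rewrite divr_gt0.
  move=> x y hx hy.
  have hs : cmod (pc (x, y) - pc p) <= `|x - p.1| + `|y - p.2|.
    exact: (ler_cmod_sum (pc (x, y) - pc p)).
  have := h (pc (x, y) - pc p); rewrite [pc p + _]addrC subrK => H.
  apply: le_trans (H _) _; first by apply: le_lt_trans hs _; lra.
  by rewrite ler_wpM2l // ltW.
split=> e /key[d d0 h]; exists d => // x y hx hy; apply: le_trans (h x y hx hy).
- apply: le_trans (ler_cmod_Re _); rewrite !ReB ReM /=.
  by rewrite le_eqVlt; apply/orP; left; apply/eqP; congr `|_|; ring.
- apply: le_trans (ler_cmod_Im _); rewrite !ImB ImM /=.
  by rewrite le_eqVlt; apply/orP; left; apply/eqP; congr `|_|; ring.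
Qed.

Lemma lin_approx_continuous (f : R * R -> R) p A B : lin_approx f p A B ->
  {for p, continuous f}.
Proof.
move=> hf; apply/cvgrPdist_le => e e0.
have [d d0 h] := hf 1 ltr01.
pose K := `|A| + `|B| + 2.
have K0 : 0 < K by rewrite /K; have := normr_ge0 A; have := normr_ge0 B; lra.
apply: (filterS _ (@nbhsx_ballx R (R * R)%type p (Num.min d (e / K)) _)); last first.
  by rewrite lt_min d0 divr_gt0.
move=> [x y] [] /=; rewrite /ball /= !lt_min => /andP[hx1 hx2] /andP[hy1 hy2].
rewrite distrC in hx1 hx2; rewrite distrC in hy1 hy2.
have := h x y hx1 hy1; rewrite mul1r.
move: hx2 hy2; rewrite !ltr_pdivlMr // => hx2 hy2 hh.
rewrite distrC.
have -> : f (x, y) - f p = (f (x, y) - f p - A * (x - p.1) - B * (y - p.2)) +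
  (A * (x - p.1) + B * (y - p.2)) by ring.
apply: le_trans (ler_normD _ _) _.
have := ler_normD (A * (x - p.1)) (B * (y - p.2)); rewrite !normrM.
have nx := normr_ge0 (x - p.1); have ny := normr_ge0 (y - p.2).
have nA := normr_ge0 A; have nB := normr_ge0 B.
move: hx2 hy2; rewrite /K; nra.
Qed.

Lemma holo_sqr_continuous (g : R[i] -> R[i]) (p : R * R) :
  derivable (g : R[i]^o -> R[i]^o) (pc p) 1 ->
  {for p, continuous (fun q => cmod (g (pc q)) ^+ 2)}.
Proof.
move=> /derivable_cdiff[g' /cdiff_lin_approx[h1 h2]].
rewrite (_ : (fun q => cmod (g (pc q)) ^+ 2) = (fun q => complex.Re (g (pc q)) * complex.Re (g (pc q))
     + complex.Im (g (pc q)) * complex.Im (g (pc q)))); last first.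
  by apply/funext => q; rewrite cmod_sqr !expr2.
have := lin_approx_continuous h1; have := lin_approx_continuous h2.
by move=> c2 c1; apply: cvgD; apply: cvgM.
Qed.

End slices.

(** * The area sub-mean value inequality *)

Section bump.
Context {R : realType}.
Variables (x0 y0 d : R).
Hypothesis d0 : 0 < d.

(** The square of [bump] is continuously differentiable, and its gradient at
    [z] is a real multiple of [z - z0]: multiplied by a difference quotient
    centred at [z0], this gives back the function itself. *)
Definition bump (p : R * R) : R :=
  Num.max 0 (d ^+ 2 - (p.1 - x0) ^+ 2 - (p.2 - y0) ^+ 2).

Lemma bump_ge0 p : 0 <= bump p.
Proof. by rewrite /bump le_max lexx. Qed.

Lemma bump_le p : bump p <= d ^+ 2.
Proof. by rewrite /bump ge_max; have := sqr_ge0 (p.1 - x0); have := sqr_ge0 (p.2 - y0); nra. Qed.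

Lemma bump_eq0 p : d ^+ 2 <= (p.1 - x0) ^+ 2 + (p.2 - y0) ^+ 2 -> bump p = 0.
Proof. by move=> h; apply/eqP; rewrite /bump eq_maxl; lra. Qed.

Lemma bump_ge p : d ^+ 2 - (p.1 - x0) ^+ 2 - (p.2 - y0) ^+ 2 <= bump p.
Proof. by rewrite /bump le_max lexx orbT. Qed.

Lemma maxr0_sqr_expansion (s t : R) :
  `|Num.max 0 t ^+ 2 - Num.max 0 s ^+ 2 - 2 * Num.max 0 s * (t - s)| <= (t - s) ^+ 2.
Proof.
have st := sqr_ge0 t; have ss := sqr_ge0 s; have sts := sqr_ge0 (t - s).
rewrite ler_norml; have [ht|ht] := leP 0 t; have [hs|hs] := leP 0 s.
- by apply/andP; split; nra.
- have : 0 <= t * - s by rewrite mulr_ge0 //; lra.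
  by move=> ?; apply/andP; split; nra.
- have : 0 <= s * - t by rewrite mulr_ge0 //; lra.
  by move=> ?; apply/andP; split; nra.
- by rewrite expr0n /=; apply/andP; split; nra.
Qed.

Lemma bump_continuous : continuous bump.
Proof.
move=> p.
apply: (@continuous_max R (R * R)%type (fun=> 0)
  (fun q => d ^+ 2 - (q.1 - x0) ^+ 2 - (q.2 - y0) ^+ 2) p); first exact: cvg_cst.
have c1 : {for p, continuous (fun q : R * R => (q.1 - x0) ^+ 2)}.
  apply: (@continuous_comp _ _ _ (fun q : R * R => q.1 - x0) (fun x => x ^+ 2)).
    by apply: cvgB; [exact: cvg_fst|exact: cvg_cst].
  exact: exprn_continuous.
have c2 : {for p, continuous (fun q : R * R => (q.2 - y0) ^+ 2)}.
  apply: (@continuous_comp _ _ _ (fun q : R * R => q.2 - y0) (fun x => x ^+ 2)).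
    by apply: cvgB; [exact: cvg_snd|exact: cvg_cst].
  exact: exprn_continuous.
by apply: cvgB => //; apply: cvgB => //; exact: cvg_cst.
Qed.

Lemma bump_sqr_lin_approx p : lin_approx (fun q => bump q ^+ 2) p
  (- 4 * bump p * (p.1 - x0)) (- 4 * bump p * (p.2 - y0)).
Proof.
move=> e e0.
set a := p.1 - x0; set b := p.2 - y0.
pose K := 2 * `|a| + 2 * `|b| + 1.
have na := normr_ge0 a; have nb := normr_ge0 b.
have K1 : 1 <= K by rewrite /K; lra.
have b0 := bump_ge0 p.
pose M := 2 * (K ^+ 2 + 2 * bump p).
have M0 : 0 < M by rewrite /M; nra.
exists (Num.min (1 / 2) (e / M)); first by rewrite lt_min divr_gt0 // divr_gt0.
move=> x y; rewrite !lt_min => /andP[hx1 hx2] /andP[hy1 hy2].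
pose t := d ^+ 2 - (x - x0) ^+ 2 - (y - y0) ^+ 2.
pose s := d ^+ 2 - a ^+ 2 - b ^+ 2.
have := maxr0_sqr_expansion s t.
rewrite -/(bump (x, y)) -/(bump p).
move: hx1 hx2 hy1 hy2; set u := x - p.1; set v := y - p.2 => hx1 hx2 hy1 hy2.
have nu := normr_ge0 u; have nv := normr_ge0 v.
have ts : t - s = - 2 * a * u - 2 * b * v - u ^+ 2 - v ^+ 2.
  by rewrite /t /s /a /b /u /v; ring.
have su : u ^+ 2 = `|u| ^+ 2 by rewrite real_normK // num_real.
have sv : v ^+ 2 = `|v| ^+ 2 by rewrite real_normK // num_real.
have hts : `|t - s| <= K * (`|u| + `|v|).
  have h1 : `|t - s| <= 2 * `|a| * `|u| + 2 * `|b| * `|v| + u ^+ 2 + v ^+ 2.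
    have := ler_norm (a * u); have := ler_norm (- (a * u)).
    have := ler_norm (b * v); have := ler_norm (- (b * v)).
    rewrite !normrN !normrM ts ler_norml; nra.
  apply: le_trans h1 _; rewrite su sv /K; nra.
have hts2 : (t - s) ^+ 2 <= K ^+ 2 * (`|u| + `|v|) ^+ 2.
  by rewrite -(real_normK (num_real (t - s))) -exprMn ler_pXn2r // nnegrE mulr_ge0 //; lra.
move=> h.
have -> : bump (x, y) ^+ 2 - bump p ^+ 2 - (- 4 * bump p * a) * u - (- 4 * bump p * b) * v =
  (bump (x, y) ^+ 2 - bump p ^+ 2 - 2 * bump p * (t - s)) - 2 * bump p * (u ^+ 2 + v ^+ 2).
  by rewrite ts; ring.
apply: le_trans (ler_normB _ _) _.
rewrite [X in _ + X]ger0_norm; last by rewrite mulr_ge0 ?mulr_ge0 // addr_ge0 // sqr_ge0.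
set m := `|u| + `|v|.
have m0 : 0 <= m by rewrite addr_ge0.
have mM : m * M <= 2 * e.
  move: hx2 hy2; rewrite !ltr_pdivlMr // /m; lra.
have : u ^+ 2 + v ^+ 2 <= m ^+ 2 by rewrite su sv /m; nra.
have : K ^+ 2 * m ^+ 2 + 2 * bump p * m ^+ 2 <= e * m.
  have -> : K ^+ 2 * m ^+ 2 + 2 * bump p * m ^+ 2 = (m * M / 2) * m by rewrite /M; field.
  by rewrite ler_wpM2r //; lra.
move: h hts2; rewrite -/m => h hts2 h3 h4.
have : 2 * bump p * (u ^+ 2 + v ^+ 2) <= 2 * bump p * m ^+ 2 by rewrite ler_wpM2l //; lra.
lra.
Qed.

End bump.

Section support.
Context {R : realType}.
Implicit Types (f : R * R -> R).

Lemma lin_approxN f p A B : lin_approx f p A B -> lin_approx (fun q => - f q) p (- A) (- B).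
Proof.
move=> h e e0; have [d d0 hd] := h e e0; exists d => // x y hx hy.
by apply: le_trans (hd x y hx hy); rewrite -normrN; rewrite le_eqVlt; apply/orP; left; apply/eqP; congr `|_|; ring.
Qed.

Lemma lin_approx_zero f p (d : R) : 0 < d ->
  (forall x y, `|x - p.1| < d -> `|y - p.2| < d -> f (x, y) = 0) -> lin_approx f p 0 0.
Proof.
move=> d0 h e e0; exists d => // x y hx hy; rewrite h //.
have -> : f p = 0 by case: p h {hx hy} => a b h; apply: h; rewrite /= subrr normr0.
by rewrite !mul0r !subr0 normr0 mulr_ge0 // ?ltW // addr_ge0.
Qed.

Lemma compact_support_bounded f (a b c d : R) : continuous f ->
  (forall x y, ~~ ((a <= x <= b) && (c <= y <= d)) -> f (x, y) = 0) ->
  exists M : R, forall p, `|f p| <= M.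
Proof.
move=> cf h.
have : compact (`[a, b]%classic `*` `[c, d]%classic : set (R * R)).
  by apply: compact_setX; exact: segment_compact.
have cs : {within (`[a, b]%classic `*` `[c, d]%classic : set (R * R)), continuous f}.
  by apply: continuous_subspaceT.
move=> /(continuous_compact cs) /compact_bounded [M [Mr hM]].
exists (Num.max 0 (M + 1)) => -[x y].
have [hxy|/h ->] := boolP ((a <= x <= b) && (c <= y <= d)); last first.
  by rewrite normr0 le_max lexx.
rewrite le_max; apply/orP; right; apply: hM; first by rewrite ltrDl.
by exists (x, y) => //=; move: hxy => /andP[h1 h2]; rewrite !in_itv /= h1 h2.
Qed.

Lemma box_integral_fin f (a c l : R) : continuous f ->
  (\int[lebesgue_plane]_(p in box a c l) (f p)%:E)%E = (box_int f a c l)%:E.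
Proof.
move=> cf; rewrite /box_int /Rintegral fineK //.
apply: integrable_fin_num; first exact: measurable_box.
exact: box_integrable.
Qed.

End support.

Section submean.
Context {R : realType}.
Local Notation pc := (@pair_to_complex R).

Lemma ler_cmod_pcB p q : cmod (pc p - pc q) <= `|p.1 - q.1| + `|p.2 - q.2|.
Proof. exact: (ler_cmod_sum (pc p - pc q)). Qed.

Definition disc (z : R[i]) (d : R) : set (measurableTypeR R * measurableTypeR R) :=
  [set p | cmod (pc p - z) < d].

Lemma open_disc z d : open (disc z d : set (R * R)).
Proof.
rewrite openE => p /= hp.
pose r := (d - cmod (pc p - z)) / 2.
have r0 : 0 < r by rewrite divr_gt0 // subr_gt0.
apply: (filterS _ (@nbhsx_ballx R (R * R)%type p r r0)) => q [].
rewrite /ball /= => h1 h2; rewrite /disc /=.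
have -> : pc q - z = (pc q - pc p) + (pc p - z) by rewrite addrA subrK.
apply: le_lt_trans (ler_cmodD _ _) _.
have := ler_cmod_sum (pc q - pc p); rewrite /= -[`|p.1 + _|]distrC in h1 *.
move: h1 h2; rewrite distrC (distrC p.2) /r; lra.
Qed.

Lemma measurable_disc z d : measurable (disc z d).
Proof. by apply: plane_open_measurable; exact: open_disc. Qed.

Lemma disk_coordE : disk_coord = disc (0 : R[i]) 1.
Proof.
by apply/seteqP; split => p; rewrite /disk_coord /disc /preimage /mkset subr0 => /unit_diskP.
Qed.

Lemma measurable_disk_coord :
  measurable (disk_coord : set (measurableTypeR R * measurableTypeR R)).
Proof. by rewrite disk_coordE; exact: measurable_disc. Qed.

(** Let [D w = (G w - G z) / (w - z)] and let [k] be the bump.  By the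
    Cauchy-Riemann equations the field [(Re D * k^2, - Im D * k^2)] has
    divergence [- 4 * k * Re (G - G z)], so [Re G - 1] has integral zero against
    [k].  As [2 * (Re G - 1) <= |G|^2 - 1], the integral of [k] is at most that
    of [k * |G|^2]. *)
Theorem submean (G : R[i] -> R[i]) (z : R[i]) (d d' : R) : 0 < d -> d < d' ->
  (forall w, cmod (w - z) < d' -> derivable (G : R[i]^o -> R[i]^o) w 1) ->
  complex.Re (G z) = 1 ->
  ((d ^+ 2 / 2)%:E <= \int[lebesgue_plane]_(p in disc z d) (cmod (G (pc p)) ^+ 2)%:E)%E.
Proof.
case: z => x0 y0; set z := x0 +i* y0 => d0 dd' hG Gz1.
have cmz p : cmod (pc p - z) ^+ 2 = (p.1 - x0) ^+ 2 + (p.2 - y0) ^+ 2 by rewrite cmod_sqr.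
pose k := bump x0 y0 d.
have k0 p : 0 <= k p by exact: bump_ge0.
have ck : continuous k by exact: bump_continuous.
have kout p : d <= cmod (pc p - z) -> k p = 0.
  move=> h; apply: bump_eq0; rewrite -cmz ler_pXn2r // nnegrE ?cmod_ge0 //; exact: ltW.
have out p : d < cmod (pc p - z) -> exists2 r : R, 0 < r &
    forall x y, `|x - p.1| < r -> `|y - p.2| < r -> k (x, y) = 0.
  move=> hp; pose r := (cmod (pc p - z) - d) / 2.
  have r0 : 0 < r by rewrite divr_gt0 // subr_gt0.
  exists r => // x y hx hy; apply: kout.
  have := ler_cmodD (pc p - pc (x, y)) (pc (x, y) - z); rewrite addrA subrK.
  have := ler_cmod_pcB p (x, y); rewrite [(x, y).1]/= [(x, y).2]/=.
  rewrite (distrC p.1) (distrC p.2); move: hx hy; rewrite /r; lra.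
(* whatever vanishes with [k] is differentiable off the closed disc, although
   [G] is only controlled on the disc of radius [d'] *)
have outA (f : R * R -> R) p : d < cmod (pc p - z) -> (forall q, k q = 0 -> f q = 0) ->
    lin_approx f p 0 0.
  move=> /out[r r0 hr] hf; apply: (lin_approx_zero r0) => x y hx hy.
  by apply: hf; exact: hr.
have Gdiff w : cmod (w - z) < d' -> exists g, cdiff G w g.
  by move=> /hG /derivable_cdiff.
have cReG p : cmod (pc p - z) < d' -> {for p, continuous (fun q => complex.Re (G (pc q)))}.
  move=> /Gdiff[g /cdiff_lin_approx[h _]]; exact: lin_approx_continuous h.
have cImG p : cmod (pc p - z) < d' -> {for p, continuous (fun q => complex.Im (G (pc q)))}.
  move=> /Gdiff[g /cdiff_lin_approx[_ h]]; exact: lin_approx_continuous h.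
have cnG p : cmod (pc p - z) < d' -> {for p, continuous (fun q => cmod (G (pc q)) ^+ 2)}.
  by move=> hp; apply: holo_sqr_continuous; exact: hG.
have outC (f : R * R -> R) : (forall q, k q = 0 -> f q = 0) ->
    (forall p, cmod (pc p - z) < d' -> {for p, continuous f}) -> continuous f.
  move=> hf hc p; have [/hc//|h] := ltP (cmod (pc p - z)) d'.
  exact: lin_approx_continuous (outA f p (lt_le_trans dd' h) hf).
have [g hg] : exists g, cdiff G z g.
  by apply: Gdiff; rewrite subrr cmod0; exact: lt_trans dd'.
pose D w := if w == z then g else (G w - G z) / (w - z).
have Dz w : D w * (w - z) = G w - G z.
  rewrite /D; case: eqP => [->|/eqP wz]; first by rewrite !subrr mulr0.
  by rewrite divfK // subr_eq0.
have Ddiff w : w != z -> cmod (w - z) < d' -> exists g', cdiff D w g'.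
  move=> wz wd; apply: derivable_cdiff.
  apply: (@near_eq_derivable _ (R[i]^o) (R[i]^o) (fun w => (G w - G z) * (w - z)^-1)).
    apply/nbhs_cmodP; exists (cmod (w - z)); first by rewrite cmod_gt0 subr_eq0.
    move=> v hv; rewrite /D; case: eqP => // vz; move: hv; rewrite vz cmodB ltxx //.
  apply: derivableM; first by apply: derivableB; [exact: hG|exact: derivable_cst].
  apply: derivableV; first by rewrite subr_eq0.
  have hid : derivable (id : R[i]^o -> R[i]^o) w 1 by exact: derivable_id.
  have hcst : derivable (cst z : R[i]^o -> R[i]^o) w 1 by exact: derivable_cst.
  exact: (derivableB hid hcst).
have Dcont (e : R) : 0 < e -> exists2 r : R, 0 < r & forall w, cmod (w - z) < r -> cmod (D w - D z) <= e.
  move=> e0; have [r r0 hr] := hg e e0; exists r => // w hw.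
  rewrite /D eqxx; case: eqP => [_|/eqP wz]; first by rewrite subrr cmod0 ltW.
  have w0 : 0 < cmod (w - z) by rewrite cmod_gt0 subr_eq0.
  have := hr _ hw; rewrite [z + _]addrC subrK => h.
  rewrite -(ler_pM2r w0) -cmodM mulrBl divfK //; by rewrite subr_eq0.
have pcz : z = pc (x0, y0) by [].
have near0 (f : R[i] -> R) : (forall u v, `|f u - f v| <= cmod (u - v)) ->
    {for (x0, y0), continuous (fun q => f (D (pc q)))}.
  move=> hf; apply/cvgrPdist_le => e e0; have [r r0 hr] := Dcont e e0.
  have r20 : 0 < r / 2 by rewrite divr_gt0.
  apply: (filterS _ (@nbhsx_ballx R (R * R)%type (x0, y0) (r / 2) r20)) => q [].
  rewrite /ball /= => h1 h2; rewrite distrC; apply: le_trans (hf _ _) _.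
  apply: hr; rewrite pcz; apply: le_lt_trans (ler_cmod_pcB _ _) _.
  move: h1 h2; rewrite [(x0, y0).1]/= [(x0, y0).2]/= (distrC x0) (distrC y0); lra.
have cReD p : cmod (pc p - z) < d' -> {for p, continuous (fun q => complex.Re (D (pc q)))}.
  have [->|pz] := eqVneq p (x0, y0).
    by move=> _; apply: near0 => u v; rewrite -ReB ler_cmod_Re.
  move=> /Ddiff[|g' /cdiff_lin_approx[h _]]; last exact: lin_approx_continuous h.
  by case: p pz => a b; apply: contra => /eqP[-> ->].
have cImD p : cmod (pc p - z) < d' -> {for p, continuous (fun q => complex.Im (D (pc q)))}.
  have [->|pz] := eqVneq p (x0, y0).
    by move=> _; apply: near0 => u v; rewrite -ImB ler_cmod_Im.
  move=> /Ddiff[|g' /cdiff_lin_approx[_ h]]; last exact: lin_approx_continuous h.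
  by case: p pz => a b; apply: contra => /eqP[-> ->].
(* the real and imaginary parts of [D * k^2] as a planar field *)
pose P q := complex.Re (D (pc q)) * k q ^+ 2.
pose Q q := - complex.Im (D (pc q)) * k q ^+ 2.
pose h q := - 4 * (k q * (complex.Re (G (pc q)) - 1)).
have ck2 p : {for p, continuous (fun q => k q ^+ 2)}.
  by apply: lin_approx_continuous (@bump_sqr_lin_approx R x0 y0 d p).
have cP : continuous P.
  apply: outC => [q q0|p hp]; first by rewrite /P q0 expr0n mulr0.
  by apply: cvgM; [exact: cReD|exact: ck2].
have cQ : continuous Q.
  apply: outC => [q q0|p hp]; first by rewrite /Q q0 expr0n mulr0.
  by apply: cvgM; [apply: cvgN; exact: cImD|exact: ck2].
have ch : continuous h.
  apply: outC => [q q0|p hp]; first by rewrite /h q0 mul0r mulr0.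
  apply: cvgM; first exact: cvg_cst.
  apply: cvgM; first exact: ck.
  by apply: cvgB; [exact: cReG|exact: cvg_cst].
have kbox x y : (d <= `|x - x0|) || (d <= `|y - y0|) -> k (x, y) = 0.
  move=> /orP[] hxy; apply: kout; apply: le_trans hxy _.
    by apply: le_trans (ler_cmod_Re _); rewrite lexx.
  by apply: le_trans (ler_cmod_Im _); rewrite lexx.
have bnd (f : R * R -> R) : continuous f -> (forall q, k q = 0 -> f q = 0) ->
    exists M : R, forall p, `|f p| <= M.
  move=> cf hf; apply: (@compact_support_bounded _ f (x0 - d) (x0 + d) (y0 - d) (y0 + d)) => // x y.
  move=> hxy; apply: hf; apply: kbox; apply: contraR hxy.
  by rewrite negb_or -!ltNge !ltr_norml => /andP[? ?]; apply/andP; split; lra.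
have [M1 hM1] : exists M : R, forall p, `|P p| <= M.
  by apply: bnd => // q q0; rewrite /P q0 expr0n mulr0.
have [M2 hM2] : exists M : R, forall p, `|Q p| <= M.
  by apply: bnd => // q q0; rewrite /Q q0 expr0n mulr0.
have [M3 hM3] : exists M : R, forall p, `|h p| <= M.
  by apply: bnd => // q q0; rewrite /h q0 mul0r mulr0.
have int0 : box_int h (x0 - d) (y0 - d) (d + d) = 0.
  apply: (@divergence_compact_support _ P Q h x0 y0 d (Num.max M1 (Num.max M2 M3))) => //.
  - by move=> p; rewrite le_max hM1.
  - by move=> p; rewrite !le_max hM2 orbT.
  - by move=> p; rewrite !le_max hM3 !orbT.
  - move=> p pz; have [hp|hp] := ltP (cmod (pc p - z)) d'; last first.
      have hdp := lt_le_trans dd' hp.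
      exists 0, 0, 0, 0; split.
      + by apply: outA => // q q0; rewrite /P q0 expr0n mulr0.
      + by apply: outA => // q q0; rewrite /Q q0 expr0n mulr0.
      + by rewrite /h kout ?mul0r ?mulr0 ?addr0 // ltW.
    have [|g' /cdiff_lin_approx[h1 h2]] := Ddiff (pc p) _ hp.
      by apply/eqP => E; apply: pz; case: p E {hp} => a b [-> ->].
    have h3 := @bump_sqr_lin_approx R x0 y0 d p.
    have h4 := lin_approxM h1 h3.
    have h5 := lin_approxM (lin_approxN h2) h3.
    do 4 eexists; split; [exact: h4|exact: h5|].
    have := Dz (pc p) => /(congr1 (@complex.Re R)); rewrite ReM !ReB !ImB Gz1 /= => E.
    by rewrite /h -E -/k; ring.
  - by move=> x y hxy; rewrite /P /Q kbox // expr0n !mulr0.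
pose k2 q := k q * cmod (G (pc q)) ^+ 2.
have ck2' : continuous k2.
  apply: outC => [q q0|p hp]; first by rewrite /k2 q0 mul0r.
  by apply: cvgM; [exact: ck|exact: cnG].
have int_le : box_int k (x0 - d) (y0 - d) (d + d) <= box_int k2 (x0 - d) (y0 - d) (d + d).
  have I f := @box_integrable R f (x0 - d) (y0 - d) (d + d).
  have E : box_int (fun q => k q + (- 2^-1) * h q) (x0 - d) (y0 - d) (d + d) =
      box_int k (x0 - d) (y0 - d) (d + d).
    have mb := measurable_box (x0 - d) (y0 - d) (d + d).
    have Ih := I _ ch.
    have EZ : box_int (fun q => (- 2^-1) * h q) (x0 - d) (y0 - d) (d + d) = 0.
      by rewrite /box_int (RintegralZl _ mb Ih) -[X in _ * X]/(box_int h _ _ _) int0 mulr0.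
    rewrite -[RHS]addr0 -EZ; apply: RintegralD => //; first exact: I.
    by apply: I => q; apply: cvgM; [exact: cvg_cst|exact: ch].
  rewrite -E /box_int; apply: le_Rintegral.
  - exact: measurable_box.
  - by apply: I => q; apply: cvgD; [exact: ck|apply: cvgM; [exact: cvg_cst|exact: ch]].
  - exact: I.
  - move=> q _; rewrite /k2 /h cmod_sqr.
    have := sqr_ge0 (complex.Re (G (pc q)) - 1); have := sqr_ge0 (complex.Im (G (pc q))).
    move: (k0 q) (complex.Re _) (complex.Im _) => kq a b hb ha.
    have : 0 <= k q * ((a - 1) ^+ 2 + b ^+ 2) by rewrite mulr_ge0 // addr_ge0.
    lra.
(* the bump is at least [d^2 / 2] on the concentric square of side [d] *)
have low : ((d ^+ 2)%:E * (d ^+ 2 / 2)%:E <= (box_int k (x0 - d) (y0 - d) (d + d))%:E)%E.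
  rewrite -box_integral_fin //.
  have mk (D' : set (measurableTypeR R * measurableTypeR R)) : measurable D' ->
      measurable_fun D' (fun q : measurableTypeR R * measurableTypeR R => (k q)%:E).
    move=> mD; apply/measurable_EFinP.
    by apply: measurable_funS (plane_continuous_measurableT ck).
  apply: (@le_trans _ _ (\int[lebesgue_plane]_(p in box (x0 - d / 2) (y0 - d / 2) d) (k p)%:E)%E).
    rewrite muleC -[X in (_ * X)%E](box_measure (x0 - d / 2) (y0 - d / 2) d0).
    rewrite -integral_cst; last exact: measurable_box.
    apply: ge0_le_integral => //.
    - exact: measurable_box.
    - by move=> q _; rewrite lee_fin divr_ge0 // sqr_ge0.
    - by apply: mk; exact: measurable_box.
    - move=> [x y]; rewrite /box /= !in_itv /= => -[hx hy]; rewrite lee_fin.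
      apply: le_trans (bump_ge x0 y0 d (x, y)) => /=; nra.
  apply: ge0_subset_integral; try exact: measurable_box.
  - by apply: mk; exact: measurable_box.
  - by move=> q _; rewrite lee_fin.
  - by move=> [x y]; rewrite /box /= !in_itv /= => -[hx hy]; lra.
have int_leE : ((box_int k (x0 - d) (y0 - d) (d + d))%:E <= (box_int k2 (x0 - d) (y0 - d) (d + d))%:E)%E.
  by rewrite lee_fin.
have {}low := le_trans low int_leE.
rewrite -(@lee_pmul2l _ (d ^+ 2)%:E) ?lte_fin ?exprn_gt0 //.
apply: (le_trans low).
have mG : measurable_fun (disc z d) (fun p => (cmod (G (pc p)) ^+ 2)%:E).
  apply/measurable_EFinP; apply: plane_continuous_measurable; first exact: open_disc.
  by move=> p hp; apply: cnG; exact: lt_trans hp dd'.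
rewrite -ge0_integralZl //; last 3 first.
- exact: measurable_disc.
- by move=> p _; rewrite lee_fin sqr_ge0.
- by rewrite lee_fin sqr_ge0.
rewrite -box_integral_fin //.
have -> : (\int[lebesgue_plane]_(p in box (x0 - d) (y0 - d) (d + d)) (k2 p)%:E =
    \int[lebesgue_plane]_(p in disc z d) (k2 p)%:E)%E.
  rewrite integral_mkcond [RHS]integral_mkcond; congr integral.
  apply/funext => -[x y]; rewrite !patchE.
  have [kz|kz] := eqVneq (k (x, y)) 0.
    rewrite /k2 kz mul0r; case: ((x, y) \in box _ _ _); by case: ((x, y) \in disc _ _).
  have hin : cmod (pc (x, y) - z) < d.
    by rewrite ltNge; apply: contra kz => /kout ->.
  have hk : ~~ ((d <= `|x - x0|) || (d <= `|y - y0|)).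
    by apply: contra kz => /kbox ->.
  have hd : (x, y) \in disc z d by rewrite inE.
  have hb : (x, y) \in box (x0 - d) (y0 - d) (d + d).
    rewrite inE /box /= !in_itv /=.
    by move: hk; rewrite negb_or -!ltNge !ltr_norml => /andP[? ?]; split; lra.
  by rewrite hd hb.
apply: ge0_le_integral.
- exact: measurable_disc.
- by move=> p _; rewrite lee_fin mulr_ge0 // sqr_ge0.
- apply/measurable_EFinP; apply: measurable_funS (plane_continuous_measurableT ck2') => //.
- by apply: emeasurable_funM => //; exact: measurable_cst.
- move=> p _; rewrite -EFinM lee_fin ler_wpM2r ?sqr_ge0 //; exact: bump_le.
Qed.

End submean.

(** * One-variable estimates for radial weights *)

Section profile_calculus.
Context {R : realType}.
(** [p] is the radial profile of [varphi], [a r = r * p' r], and [t] is the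
    profile of [tau]; the equation for [a'] is the radial form of
    [Delta varphi = tau ^- 2].  The constant 48 is what [a_gap_left] needs to
    compare values of [t] at distance [48 * t r]. *)
Variables (p a t : R -> R) (r0 : R).
Hypotheses (r0_ge : 1 <= r0 *+ 2) (r0_lt1 : r0 < 1).
Hypothesis p_diff : forall r : R, 0 < r < 1 -> is_derive r 1 p (a r / r).
Hypothesis p_cont : forall r : R, 0 <= r < 1 -> {for r, continuous p}.
Hypothesis a_diff : forall r : R, 0 < r < 1 -> is_derive r 1 a (r / t r ^+ 2).
Hypothesis a_cont : forall r : R, 0 <= r < 1 -> {for r, continuous a}.
Hypothesis a0 : a 0 = 0.
Hypothesis t_gt0 : forall r : R, 0 < r < 1 -> 0 < t r.
Hypothesis t_noninc : forall r s : R, r0 <= r -> r <= s -> s < 1 -> t s <= t r.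
Hypothesis t_lip : forall r s : R, r0 <= r < 1 -> r0 <= s < 1 -> `|t r - t s| * 48 <= `|r - s|.
Hypothesis t_cvg : t r @[r --> 1^'-] --> 0.

Lemma within_cont (f : R -> R) (u v : R) : 0 <= u -> v < 1 ->
  (forall r : R, 0 <= r < 1 -> {for r, continuous f}) -> {within `[u, v], continuous f}.
Proof.
move=> u0 v1 cf; apply: continuous_in_subspaceT => x; rewrite inE /= in_itv /= => /andP[h1 h2].
by apply: cf; rewrite (le_trans u0 h1) (le_lt_trans h2 v1).
Qed.

Lemma a_mvt (u v : R) : 0 <= u -> u < v -> v < 1 ->
  exists2 x, u < x < v & a v - a u = x / t x ^+ 2 * (v - u).
Proof.
move=> u0 uv v1; have [|x] := @MVT _ a (fun r => r / t r ^+ 2) _ _ uv _ (within_cont u0 v1 a_cont).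
  by move=> x; rewrite in_itv /= => /andP[h1 h2]; apply: a_diff; lra.
by rewrite in_itv /= => h e; exists x.
Qed.

Lemma a_nondec (u v : R) : 0 <= u -> u <= v -> v < 1 -> a u <= a v.
Proof.
move=> u0; rewrite le_eqVlt => /predU1P[->//|uv] v1; have [x hx e] := a_mvt u0 uv v1.
rewrite -subr_ge0 e mulr_ge0 ?subr_ge0 ?(ltW uv) // divr_ge0 ?sqr_ge0 //; lra.
Qed.

Lemma a_ge0 (u : R) : 0 <= u < 1 -> 0 <= a u.
Proof. by move=> /andP[u0 u1]; rewrite -a0; exact: a_nondec. Qed.

Lemma p_nondec (u v : R) : 0 <= u -> u <= v -> v < 1 -> p u <= p v.
Proof.
move=> u0; rewrite le_eqVlt => /predU1P[->//|uv] v1.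
have [|x] := @MVT _ p (fun r => a r / r) _ _ uv _ (within_cont u0 v1 p_cont).
  by move=> x; rewrite in_itv /= => /andP[h1 h2]; apply: p_diff; lra.
rewrite in_itv /= => h e; rewrite -subr_ge0 e mulr_ge0 ?subr_ge0 ?(ltW uv) //.
by rewrite divr_ge0 //; [apply: a_ge0|]; lra.
Qed.

(** [t] tends to 0 at 1 with slope at most [1 / 48].  In particular intervals of
    length comparable to [t r] around [r] stay inside [0, 1[. *)
Lemma t_le_gap (r : R) : r0 <= r < 1 -> t r * 48 <= 1 - r.
Proof.
move=> hr.
have hl : (t r - (s - r) / 48) @[s --> (1:R)^'-] --> t r - (1 - r) / 48.
  apply: cvgB; first exact: cvg_cst.
  apply: cvgM; last exact: cvg_cst.
  apply: cvgB; last exact: cvg_cst.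
  exact: cvg_at_left_filter cvg_id.
have := ler_cvg_to hl t_cvg.
move=> H; suff : t r - (1 - r) / 48 <= 0 by lra.
apply: H; near=> s.
have hs : r < s < 1.
  by apply/andP; split; near: s; [apply: nbhs_left_gt; lra|exact: nbhs_left_lt].
have hs' : r0 <= s < 1 by lra.
have := t_lip hr hs'; rewrite (distrC r) (gtr0_norm (_ : 0 < s - r)); last by lra.
have := ler_norm (t r - t s); lra.
Unshelve. all: by end_near. Qed.

(** The logarithm of [s ^+ n * exp (- p s)], which is the weight of the monomial
    of degree [n / 2] on the circle of radius [s]. *)
Definition logmass (n s : R) : R := n * ln s - p s.

Lemma logmass_mvt (n u v : R) : 0 < u -> u < v -> v < 1 ->
  exists2 x, u < x < v & logmass n v - logmass n u = (n - a x) / x * (v - u).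
Proof.
move=> u0 uv v1.
have der (x : R) : 0 < x < 1 -> is_derive x 1 (logmass n) ((n - a x) / x).
  move=> hx; have x0 : 0 < x by lra.
  have d1 := is_derive1_ln x0.
  have d2 := p_diff hx.
  rewrite (_ : logmass n = n *: (@ln R) - p); last by apply/funext.
  apply: is_derive_eq.
  by rewrite /GRing.scale /=; field; rewrite gt_eqF.
have [||x] := @MVT _ (logmass n) (fun r => (n - a r) / r) _ _ uv.
- by move=> x; rewrite in_itv /= => /andP[h1 h2]; apply: der; lra.
- apply: continuous_in_subspaceT => x; rewrite inE /= in_itv /= => /andP[h1 h2].
  apply: differentiable_continuous; apply/derivable1_diffP.
  by have [] := der x; first by lra.
- by rewrite in_itv /= => h e; exists x.
Qed.

(** To the right [t] only gets smaller, hence [a'] only larger. *)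
Lemma a_gap_right (r x : R) : r0 <= r -> r < x -> x < 1 ->
  a r + (x - r) / (2 * t r ^+ 2) <= a x.
Proof.
have rge := r0_ge; move=> hr rx x1.
have [|||y hy e] := @a_mvt r x; [lra..|].
have tr : 0 < t r by apply: t_gt0; lra.
have ty : 0 < t y by apply: t_gt0; lra.
have tyT : t y <= t r by apply: t_noninc; lra.
rewrite -lerBrDl e ler_pdivrMr ?mulr_gt0 ?exprn_gt0 //.
have : 1 <= t r ^+ 2 / t y ^+ 2.
  by rewrite ler_pdivlMr ?exprn_gt0 // mul1r ler_pXn2r // nnegrE ltW.
set q := t r ^+ 2 / t y ^+ 2 => q1.
have -> : y / t y ^+ 2 * (x - r) * (2 * t r ^+ 2) = (x - r) * (2 * y * q).
  by rewrite /q; ring.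
by clear e; rewrite ler_peMr; nra.
Qed.

(** To the left [t] at most doubles over a distance [48 * t r]. *)
Lemma a_gap_left (r x : R) : r0 <= x -> r - 48 * t r <= x -> x < r -> r < 1 ->
  a x + (r - x) / (8 * t r ^+ 2) <= a r.
Proof.
have rge := r0_ge; move=> hx xT xr r1.
have [|||y hy e] := @a_mvt x r; [lra..|].
have tr : 0 < t r by apply: t_gt0; lra.
have ty : 0 < t y by apply: t_gt0; lra.
have tyT : t y <= 2 * t r.
  have hy0 : r0 <= y < 1 by lra.
  have hr0 : r0 <= r < 1 by lra.
  have := t_lip hy0 hr0; rewrite (distrC y) (gtr0_norm (_ : 0 < r - y)); last by lra.
  have := ler_norm (t y - t r); lra.
rewrite -lerBrDl e ler_pdivrMr ?mulr_gt0 ?exprn_gt0 //.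
have : 1 <= (2 * t r) ^+ 2 / t y ^+ 2.
  rewrite ler_pdivlMr ?exprn_gt0 // mul1r ler_pXn2r // nnegrE ?(ltW ty) //.
  by rewrite mulr_ge0 // ltW.
set q := (2 * t r) ^+ 2 / t y ^+ 2 => q1.
have -> : y / t y ^+ 2 * (r - x) * (8 * t r ^+ 2) = (r - x) * (2 * y * q).
  by rewrite /q; ring.
by clear e; rewrite ler_peMr; nra.
Qed.

(** The derivative [(n - a s) / s] is at most of order [1 / t r] on an interval of
    length [12 * t r], after which [a] has outgrown [n] and [logmass]
    decreases. *)
Lemma logmass_le_right (n r s : R) : r0 <= r -> r < s -> s < 1 ->
  n - a r <= 6 / t r -> logmass n s <= logmass n r + 144.
Proof.
have rge := r0_ge; move=> hr rs s1 hn.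
have t0 : 0 < t r by apply: t_gt0; lra.
have near x : r < x -> x < 1 -> x <= r + 12 * t r -> logmass n x <= logmass n r + 144.
  move=> rx x1 xT; have [|||y hy e] := @logmass_mvt n r x; [lra..|].
  have ay : a r <= a y by apply: a_nondec; lra.
  suff : (n - a y) / y * (x - r) <= 144 by lra.
  rewrite mulrAC ler_pdivrMr; last by lra.
  have h1 : n - a y <= 6 / t r by lra.
  clear e; have [h2|h2] := leP (n - a y) 0; first by nra.
  have : (n - a y) * (x - r) <= 6 / t r * (12 * t r) by apply: ler_pM; lra.
  have -> : 6 / t r * (12 * t r) = 72 by field; rewrite gt_eqF.
  lra.
have [sT|sT] := leP s (r + 12 * t r); first exact: near.
pose v := r + 12 * t r.
have nv : logmass n v <= logmass n r + 144 by apply: near; rewrite /v; lra.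
have v0 : 0 < v by rewrite /v; lra.
have [y hy e] := logmass_mvt n v0 sT s1.
have := @a_gap_right r y hr; rewrite /v in hy => upy.
have {}upy : a r + (y - r) / (2 * t r ^+ 2) <= a y by apply: upy; lra.
have E : (12 * t r) / (2 * t r ^+ 2) = 6 / t r by field; rewrite gt_eqF.
have hy1 : 6 / t r <= (y - r) / (2 * t r ^+ 2).
  by rewrite -E ler_pM2r ?invr_gt0 ?mulr_gt0 ?exprn_gt0 //; lra.
have : (n - a y) / y * (s - v) <= 0.
  rewrite mulrAC ler_pdivrMr ?mul0r; last by lra.
  by rewrite mulr_le0_ge0 //; rewrite /v; lra.
lra.
Qed.

(** Mirror image of [logmass_le_right], with length [48 * t r]. *)
Lemma logmass_le_left (n r s : R) : r0 <= r - 48 * t r -> r < 1 -> 0 < s -> s < r ->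
  a r - n <= 6 / t r -> logmass n s <= logmass n r + 576.
Proof.
have rge := r0_ge; move=> hr r1 s0 sr hn.
have rr0 : 0 < r.
  by rewrite (lt_trans s0 sr).
have t0 : 0 < t r by apply: t_gt0; rewrite rr0.
have near x : r - 48 * t r <= x -> x < r -> logmass n x <= logmass n r + 576.
  move=> hx xr; have [|||y hy e] := @logmass_mvt n x r; [lra..|].
  have ay : a y <= a r by apply: a_nondec; lra.
  suff : - 576 <= (n - a y) / y * (r - x) by lra.
  rewrite mulrAC ler_pdivlMr; last by lra.
  have h1 : - (6 / t r) <= n - a y by lra.
  clear e; have [h2|h2] := leP 0 (n - a y); first by nra.
  have : - (n - a y) * (r - x) <= 6 / t r * (48 * t r) by apply: ler_pM; lra.
  have -> : 6 / t r * (48 * t r) = 288 by field; rewrite gt_eqF.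
  lra.
have [sT|sT] := leP (r - 48 * t r) s; first exact: near.
pose v := r - 48 * t r.
have nv : logmass n v <= logmass n r + 576 by apply: near; rewrite /v; lra.
have v1 : v < 1 by rewrite /v; lra.
have sv : s < v by [].
have [y hy e] := logmass_mvt n s0 sv v1.
have := @a_gap_left r v hr (lexx _).
have -> : (r - v) / (8 * t r ^+ 2) = 6 / t r by rewrite /v; field; rewrite gt_eqF.
have vr : v < r by rewrite /v; lra.
move=> /(_ vr r1) dv.
have av : a y <= a v by apply: a_nondec; lra.
have : 0 <= (n - a y) / y * (v - s).
  rewrite mulrAC divr_ge0 //; last by lra.
  by rewrite mulr_ge0 //; lra.
lra.
Qed.

Lemma logmass_le (n r s : R) : (1 + r0) / 2 <= r < 1 -> 0 < s < 1 ->
  `|n - a r| <= 6 / t r -> logmass n s <= logmass n r + 576.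
Proof.
have rge := r0_ge; have rlt := r0_lt1; move=> hr /andP[s0 s1].
have r01 : r0 <= r < 1 by lra.
have tgap := t_le_gap r01.
rewrite ler_norml => /andP[hn1 hn2].
have [sr|rs|->] := ltrgtP s r; last by lra.
  by apply: logmass_le_left => //; lra.
have : logmass n s <= logmass n r + 144 by apply: logmass_le_right => //; lra.
lra.
Qed.

(** On an interval of length [t r] the derivative of [logmass] is of order
    [1 / t r]. *)
Lemma logmass_near (n r s : R) : (1 + r0) / 2 <= r < 1 -> `|s - r| <= t r ->
  `|n - a r| <= 2 -> [/\ 0 < s, s < 1 & logmass n r <= logmass n s + 12].
Proof.
move=> hr hs hn.
have rge := r0_ge; have rlt := r0_lt1.
have r01 : r0 <= r < 1 by lra.
have t0 : 0 < t r by apply: t_gt0; lra.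
have tgap := t_le_gap r01.
set T := t r in t0 tgap hs *.
move: hs hn; rewrite !ler_norml => hs hn.
have ts x : r0 <= x < 1 -> `|x - r| <= T -> T / 2 <= t x.
  move=> hx hxT; have := t_lip hx r01; rewrite -/T.
  have := ler_norm (- (t x - T)); rewrite normrN; lra.
have der x : r0 <= x < 1 -> `|x - r| <= T -> `|a x - a r| <= 4 / T.
  have H u v : r0 <= u -> u < v -> v < 1 -> v - u <= T ->
      `|u - r| <= T -> `|v - r| <= T -> `|a v - a u| <= 4 / T.
    move=> hu uv v1 uvT uT vT.
    have [|||y hy e] := @a_mvt u v; [lra..|].
    have ty : T / 2 <= t y by apply: ts; [lra|move: uT vT; rewrite !ler_norml; lra].
    have ty0 : 0 < t y by lra.
    rewrite e ger0_norm; last by rewrite mulr_ge0 ?divr_ge0 ?sqr_ge0 //; lra.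
    have q1 : (t y ^+ 2)^-1 <= 4 / T ^+ 2.
      rewrite -[4]invrK -invfM lef_pV2 ?posrE ?exprn_gt0 //; last first.
        by rewrite mulr_gt0 ?exprn_gt0 // invr_gt0.
      have : (T / 2) ^+ 2 <= t y ^+ 2 by rewrite ler_pXn2r // nnegrE; lra.
      lra.
    apply: (@le_trans _ _ (1 * (4 / T ^+ 2) * T)).
      apply: ler_pM; [|lra| |lra].
      - by rewrite divr_ge0 ?sqr_ge0 //; lra.
      - by apply: ler_pM; rewrite ?invr_ge0 ?sqr_ge0 //; lra.
    by rewrite le_eqVlt; apply/orP; left; apply/eqP; field; rewrite gt_eqF.
  move=> hx hxT; have rT : `|r - r| <= T by rewrite subrr normr0 ltW.
  case: (ltrgtP x r) => [xr|xr|->]; last by rewrite subrr normr0 divr_ge0 // ltW.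
  - by rewrite distrC; apply: H => //; move: hxT; rewrite ?ler_norml; lra.
  - by apply: H => //; move: hxT; rewrite ?ler_norml; lra.
have key u v : r0 <= u -> u < v -> v < 1 -> v - u <= T ->
    `|u - r| <= T -> `|v - r| <= T -> `|logmass n v - logmass n u| <= 12.
  move=> hu uv v1 uvT uT vT.
  have [|||y hy e] := @logmass_mvt n u v; [lra..|].
  have hyr : `|a y - a r| <= 4 / T by apply: der; [lra|move: uT vT; rewrite !ler_norml; lra].
  rewrite e mulrAC normrM normfV (gtr0_norm (_ : 0 < y)); last by lra.
  rewrite ler_pdivrMr; last by lra.
  rewrite normrM (gtr0_norm (_ : 0 < v - u)); last by lra.
  have h1 : `|n - a y| <= 2 + 4 / T by move: hyr; rewrite !ler_norml; lra.
  have : `|n - a y| * (v - u) <= (2 + 4 / T) * T by apply: ler_pM => //; lra.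
  have -> : (2 + 4 / T) * T = 2 * T + 4 by field; rewrite gt_eqF.
  lra.
have s1 : r0 <= s < 1 by lra.
split; [lra|lra|].
have rT : `|r - r| <= T by rewrite subrr normr0 ltW.
have sT : `|s - r| <= T by rewrite ler_norml; lra.
case: (ltrgtP s r) => [sr|sr|->]; last by lra.
- have : `|logmass n r - logmass n s| <= 12 by apply: key => //; lra.
  by rewrite ler_norml; lra.
- have : `|logmass n s - logmass n r| <= 12 by apply: key => //; lra.
  by rewrite ler_norml; lra.
Qed.

End profile_calculus.

(** * The class W in one variable *)

Section radial_laplacian.
Context {R : realType}.
Variable u : R[i] -> R.
Hypotheses (uC2 : C2_on_disk u) (urad : radial u).

Let p (r : R) := u r%:C.
Let p1 (r : R) := partial_x u r%:C.

Lemma shift_is_derive (f : R -> R) (r : R) : derivable (fun t => f (r + t)) 0 1 ->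
  is_derive r 1 f (derive1 (fun t => f (r + t)) 0).
Proof.
rewrite derive1E /derivable /derive /=.
have E : (fun h : R => h^-1 *: (((fun t => f (r + t)) \o shift 0) (h *: 1) - f (r + 0))) =
  (fun h : R => h^-1 *: ((f \o shift r) (h *: 1) - f r)).
  by apply/funext => h /=; rewrite !addr0 [r + _]addrC. 
by rewrite E => h; apply: DeriveDef.
Qed.

Lemma real_in_disk (r : R) : -1 < r < 1 -> unit_disk r%:C.
Proof. by move=> h; apply/unit_diskP; rewrite cmod_real ltr_norml. Qed.

Lemma C1_axis (v : R[i] -> R) : C1_on_disk v -> forall r : R, -1 < r < 1 ->
  is_derive r 1 (fun r => v r%:C) (partial_x v r%:C).
Proof.
move=> vC1 r /real_in_disk /vC1[h _ _ _].
have E : dx_line v r%:C = (fun t => (fun s => v s%:C) (r + t)).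
  by apply/funext => t; rewrite /dx_line; congr (v _); apply/eqP; rewrite eq_complex /= addr0 !eqxx.
by rewrite E in h; rewrite /partial_x E; exact: shift_is_derive h.
Qed.

Lemma is_derive_hypot (r T : R) : 0 < r ->
  is_derive T 1 (fun s => Num.sqrt (r ^+ 2 + s ^+ 2)) (T / Num.sqrt (r ^+ 2 + T ^+ 2)).
Proof.
move=> r0.
have pos : 0 < r ^+ 2 + T ^+ 2 by rewrite ltr_pwDl ?exprn_gt0 // sqr_ge0.
have h := is_derive1_sqrt pos.
have h2 : is_derive T 1 (fun s => r ^+ 2 + s ^+ 2) (2 * T).
  rewrite (_ : (fun s => _) = (cst (r ^+ 2) + (@id R) ^+ 2)); last by apply/funext.
  by apply: is_derive_eq; rewrite /GRing.scale /= add0r expr1 mulr1.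
have h3 : is_derive T 1 (Num.sqrt \o (fun s : R => r ^+ 2 + s ^+ 2)) ((2 * Num.sqrt (r ^+ 2 + T ^+ 2))^-1 * (2 * T)).
  exact: (@is_derive1_comp _ Num.sqrt (fun s : R => r ^+ 2 + s ^+ 2) T _ _ h h2).
rewrite (_ : T / _ = (2 * Num.sqrt (r ^+ 2 + T ^+ 2))^-1 * (2 * T)) //.
by field; rewrite gt_eqF // sqrtr_gt0.
Qed.

Lemma radialE (z : R[i]) : unit_disk z -> u z = p (cmod z).
Proof.
move=> zd; apply: urad => //.
  by apply: real_in_disk; have := cmod_ge0 z; move/unit_diskP: zd; lra.
by rewrite !norm_cmod cmod_real ger0_norm // cmod_ge0.
Qed.

Lemma disk_near_dy (z : R[i]) : unit_disk z -> \forall s \near (0 : R), unit_disk (z + s *i).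
Proof.
move=> /unit_diskP zd.
have h : 0 < 1 - cmod z by rewrite subr_gt0.
apply: filterS (@nbhs0_lt R R^o _ h) => s hs.
apply/unit_diskP; apply: le_lt_trans (ler_cmodD _ _) _.
have -> : cmod (s *i) = `|s| by rewrite cmodE /= expr0n add0r sqrtr_sqr.
by rewrite -ltrBrDl.
Qed.

Lemma partial_y_radial (r T : R) : 0 < r -> unit_disk (r +i* T) ->
  partial_y u (r +i* T) = p1 (Num.sqrt (r ^+ 2 + T ^+ 2)) * (T / Num.sqrt (r ^+ 2 + T ^+ 2)).
Proof.
move=> r0 zd; rewrite /partial_y derive1E.
have rho1 : Num.sqrt (r ^+ 2 + T ^+ 2) < 1 by move/unit_diskP: zd; rewrite cmodE.
have rho0 : 0 < Num.sqrt (r ^+ 2 + T ^+ 2).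
  by rewrite sqrtr_gt0 ltr_pwDl ?exprn_gt0 // sqr_ge0.
have [uC1 _ _] := uC2.
have h1 : is_derive (Num.sqrt (r ^+ 2 + T ^+ 2)) 1 p (p1 (Num.sqrt (r ^+ 2 + T ^+ 2))).
  by apply: C1_axis => //; lra.
have h2 := is_derive_hypot T r0.
have h3 := @is_derive1_comp _ p (fun s => Num.sqrt (r ^+ 2 + s ^+ 2)) T _ _ h1 h2.
have h4 : is_derive (0 : R) 1 (fun s : R => T + s) 1.
  rewrite (_ : (fun s => _) = (cst T + @id R)); last by apply/funext.
  by apply: is_derive_eq; rewrite add0r.
have h5 : is_derive (T + 0) 1 (p \o (fun s => Num.sqrt (r ^+ 2 + s ^+ 2)))
   (p1 (Num.sqrt (r ^+ 2 + T ^+ 2)) * (T / Num.sqrt (r ^+ 2 + T ^+ 2))) by rewrite addr0.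
have h6 := @is_derive1_comp _ _ (fun s : R => T + s) 0 _ _ h5 h4.
have := h6; rewrite mulr1 => -[_ <-].
apply: near_eq_derive; near=> s.
have sd : unit_disk ((r +i* T) + s *i) by near: s; exact: disk_near_dy.
rewrite /dy_line (radialE sd) cmodE /=; congr (p (Num.sqrt _)).
by rewrite addr0.
Unshelve. all: by end_near. Qed.

(** On the positive axis the second derivative across the axis is the derivative
    at [T = 0] of [p1 (S T) / S T * T], where [S T] is the distance of [(r, T)]
    to the origin: only the value of the first factor at 0 survives. *)
Lemma laplacian_axis (r : R) : 0 < r < 1 ->
  laplacian u r%:C = partial_x (partial_x u) r%:C + p1 r / r.
Proof.
move=> /andP[r0 r1]; rewrite /laplacian; congr (_ + _).
rewrite {1}/partial_y derive1E.
have [_ uxC1 _] := uC2.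
have rd : unit_disk r%:C by apply: real_in_disk; lra.
have S0 : Num.sqrt (r ^+ 2 + 0 ^+ 2) = r by rewrite expr0n addr0 sqrtr_sqr gtr0_norm.
pose S (T : R) : R := Num.sqrt (r ^+ 2 + T ^+ 2).
have h1 : is_derive (S 0) 1 p1 (partial_x (partial_x u) r%:C).
  by rewrite /S S0; apply: C1_axis => //; lra.
have h2 : is_derive (0 : R) 1 S (0 / S 0) := is_derive_hypot 0 r0.
have h3 := @is_derive1_comp _ p1 S 0 _ _ h1 h2.
have h4 : derivable (fun T : R => (S T)^-1) 0 1.
  apply: derivableV; last by case: h2.
  by rewrite /S S0 gt_eqF.
have h5 : derivable (fun T : R => p1 (S T) * (S T)^-1) 0 1 by apply: derivableM => //; case: h3.
have h6 : is_derive (0 : R) 1 ((fun T : R => p1 (S T) * (S T)^-1) * id) (p1 r / r).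
  have h5' := @DeriveDef _ _ _ _ _ _ _ h5 erefl.
  by apply: is_derive_eq; rewrite /= /S S0 /GRing.scale /= mul0r mulr1 addr0.
have [_ <-] := h6.
apply: near_eq_derive; near=> T.
have sd : unit_disk (r%:C + T *i) by near: T; exact: disk_near_dy.
have E : r%:C + T *i = r +i* T by apply/eqP; rewrite eq_complex /= addr0 add0r !eqxx.
rewrite /dy_line E in sd *; rewrite partial_y_radial //.
by rewrite -[RHS]/(p1 (S T) * (S T)^-1 * T) -mulrA [_^-1 * T]mulrC.
Unshelve. all: by end_near. Qed.

End radial_laplacian.

Section classW.
Context {R : realType}.

Lemma powR_half_inv_sqr (x : R) : 0 < x -> (x `^ (- 2^-1)) ^+ 2 = x^-1.
Proof.
move=> x0; rewrite -powR_mulrn ?powR_ge0 // -powRrM.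
by rewrite mulNr mulVf // powR_inv1 // ltW.
Qed.

(** [r * Delta varphi = p' + r * p''] is the derivative of [r * p'].  The radius
    [r0] is chosen so that on [r0, 1[ the function [tau] is decreasing and has
    slope at most [1 / 48]. *)
Lemma classW_profile (w : R[i] -> R) : classW w -> exists (p a t : R -> R) (r0 : R),
  (1 <= r0 *+ 2 /\ r0 < 1) /\
  [/\ forall z, unit_disk z -> w z = expR (- p (cmod z)),
      forall r : R, 0 < r < 1 -> is_derive r 1 p (a r / r),
      forall r : R, 0 <= r < 1 -> {for r, continuous p},
      forall r : R, 0 < r < 1 -> is_derive r 1 a (r / t r ^+ 2) &
      forall r : R, 0 <= r < 1 -> {for r, continuous a}] /\
  [/\ a 0 = 0,
      forall r : R, 0 < r < 1 -> 0 < t r,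
      forall r s : R, r0 <= r -> r <= s -> s < 1 -> t s <= t r,
      forall r s : R, r0 <= r < 1 -> r0 <= s < 1 -> `|t r - t s| * 48 <= `|r - s| &
      t r @[r --> 1^'-] --> 0].
Proof.
move=> [_ _ [v [[vC2 vrad] wv [C C0 lapC] [[r1' r1P' tdec'] tcvg tder tder0] _]]].
have [vC1 vxC1 _] := vC2.
have [r1 [r1P tdec]] : exists r1 : R, r1 < 1 /\
    {in `[r1, 1[ &, {homo profile (tau v) : r s /~ r <= s}}.
  by exists r1'; split => //; case/andP: r1P'.
clear r1' r1P' tdec'.
pose p (r : R) := v r%:C; pose p1 (r : R) := partial_x v r%:C.
pose a r := r * p1 r; pose t := profile (tau v).
have lap0 (r : R) : 0 < r < 1 -> 0 < laplacian v r%:C.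
  by move=> hr; apply: lt_le_trans C0 (lapC _ (real_in_disk _)); lra.
have t0 (r : R) : 0 < r < 1 -> 0 < t r.
  by move=> /lap0 h; rewrite /t /profile /tau powR_gt0.
have tsq (r : R) : 0 < r < 1 -> (t r ^+ 2)^-1 = laplacian v r%:C.
  by move=> /lap0 h; rewrite /t /profile /tau powR_half_inv_sqr // invrK.
have pd (r : R) : -1 < r < 1 -> is_derive r 1 p (p1 r) by exact: C1_axis.
have p1d (r : R) : -1 < r < 1 -> is_derive r 1 p1 (partial_x (partial_x v) r%:C) by exact: C1_axis.
have ad (r : R) : -1 < r < 1 -> is_derive r 1 a (p1 r + r * partial_x (partial_x v) r%:C).
  move=> hr; have h := p1d r hr.
  rewrite (_ : a = @id R * p1); last by apply/funext.
  by apply: is_derive_eq; rewrite /GRing.scale /= mulr1 addrC.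
have dc (f : R -> R) (r df : R) : is_derive r 1 f df -> {for r, continuous f}.
  by case=> h _; apply: differentiable_continuous; apply/derivable1_diffP.
have [r2 r2P hr2] : exists2 r2 : R, r2 < 1 & forall r, r2 < r < 1 ->
    derivable t r 1 /\ `|derive1 t r| <= 48^-1.
  have e0 : (0 : R) < 48^-1 by rewrite invr_gt0.
  have /cvgrPdist_le /(_ _ e0) near1 := tder0.
  have near2 : \forall r \near (1 : R)^'-, derivable t r 1 /\ `|0 - derive1 t r| <= 48^-1.
    exact: filterI tder near1.
  move: near2; rewrite near_withinE => /nbhs_ballP[e /= e1 he].
  exists (1 - e); first by rewrite ltrBlDr ltrDl.
  move=> r /andP[h1 h2]; have := he r; rewrite sub0r normrN; apply => //.
  by rewrite /ball /= gtr0_norm; lra.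
pose r0 := Num.max (1 / 2) (Num.max r1 ((1 + r2) / 2)).
have r01 : r0 < 1 by rewrite /r0 !gt_max; move: r1P; lra.
have [r0a r0b r0c] : [/\ 1 / 2 <= r0, r1 <= r0 & (1 + r2) / 2 <= r0].
  by rewrite /r0 !le_max !lexx !orbT.
exists p, a, t, r0; split; [split => //; lra|split; split].
- by move=> z zd; rewrite wv // (radialE vrad zd).
- move=> r hr; rewrite /a mulrAC divff ?mul1r; first by apply: pd; lra.
  by rewrite gt_eqF //; lra.
- by move=> r hr; apply: (dc _ _ _ (pd r _)); lra.
- move=> r hr; rewrite tsq //.
  have -> : r * laplacian v r%:C = p1 r + r * partial_x (partial_x v) r%:C.
    by rewrite (laplacian_axis vC2 vrad hr) /p1; field; rewrite gt_eqF //; lra.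
  by apply: ad; lra.
- by move=> r hr; apply: (dc _ _ _ (ad r _)); lra.
- by rewrite /a mul0r.
- exact: t0.
- by move=> r s hr rs s1; apply: tdec; rewrite ?in_itv /=; lra.
- have lip r s : r0 <= r -> r < s -> s < 1 -> `|t s - t r| * 48 <= s - r.
    move=> hr rs s1.
    have dt x : r <= x <= s -> is_derive x 1 t (derive1 t x).
      by move=> hx; rewrite derive1E; apply: DeriveDef => //; apply: (hr2 x _).1; lra.
    have [||x] := @MVT _ t (derive1 t) r s rs.
    + by move=> x; rewrite in_itv /= => /andP[h1 h2]; apply: dt; lra.
    + apply: continuous_in_subspaceT => x; rewrite inE /= in_itv /= => hx.
      exact: dc (dt x hx).
    + rewrite in_itv /= => hx ->; rewrite normrM (gtr0_norm (_ : 0 < s - r)) ?subr_gt0 //.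
      have [|_ ] := hr2 x _; first by lra.
      nra.
  move=> r s /andP[hr1 hr2'] /andP[hs1 hs2]; case: (ltrgtP r s) => [rs|sr|->].
  + by rewrite (distrC (t r)) lip.
  + by rewrite lip.
  + by rewrite !subrr normr0 mul0r.
- exact: tcvg.
Qed.

End classW.

Section weight.
Context {R : realType}.

Lemma expR_logmass (p : R -> R) (n : nat) (s : R) : 0 < s ->
  expR (logmass p n%:R s) = s ^+ n * expR (- p s).
Proof. by move=> s0; rewrite /logmass expRD expRM_natl lnK. Qed.

(** The two inequalities between [|y| ^+ n * w y] and [|z| ^+ n * w z] are the
    exponentiated forms of [logmass_le] and [logmass_near]. *)
Lemma weight_estimates (w : R[i] -> R) : classW w -> exists (a t : R -> R) (r1 B : R),
  [/\ 1 <= r1 *+ 2 /\ r1 < 1, 0 < B,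
      forall r, 0 <= r < 1 -> 0 <= a r,
      forall r, r1 <= r < 1 -> 0 < t r /\ t r * 48 <= 1 - r &
      forall r s, r1 <= r -> r <= s -> s < 1 -> t s <= t r] /\
  [/\ forall z, unit_disk z -> 0 < w z,
      forall y z, cmod y <= cmod z -> unit_disk z -> w z <= w y,
      forall (n : nat) y z, (0 < n)%N -> r1 <= cmod y -> unit_disk y -> unit_disk z ->
        `|n%:R - a (cmod y)| <= 6 / t (cmod y) ->
        cmod z ^+ n * w z <= B * (cmod y ^+ n * w y) &
      forall (n : nat) y z, r1 <= cmod y -> unit_disk y ->
        `|cmod z - cmod y| <= t (cmod y) -> `|n%:R - a (cmod y)| <= 2 ->
        [/\ 0 < cmod z, unit_disk z &
            cmod y ^+ n * w y <= B * (cmod z ^+ n * w z)]].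
Proof.
move=> /classW_profile[p [a [t [r0 [[r0h r01] [[wE pd pc ad ac] [a0 t0 tdec tlip tcvg]]]]]]].
have ge0 (r : R) : (1 + r0) / 2 <= r -> r < 1 -> 0 < r < 1 by lra.
exists a, t, ((1 + r0) / 2), (expR 576); split; split.
- by split; lra.
- exact: expR_gt0.
- exact: (a_ge0 ad ac a0).
- move=> r hr; split; first by apply: t0; lra.
  by apply: (t_le_gap tlip tcvg); lra.
- by move=> r s hr; apply: tdec; lra.
- by move=> z zd; rewrite wE // expR_gt0.
- move=> y z yz zd; have z1 := zd; move/unit_diskP: z1 => z1.
  rewrite !wE //; last by apply/unit_diskP; exact: le_lt_trans z1.
  by rewrite ler_expR lerN2 (p_nondec pd pc ad ac a0) // cmod_ge0.
- move=> n y z n0 ry yd zd hn.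
  (* at the origin [logmass] is meaningless, but [0 ^+ n] vanishes *)
  have [/eqP z0|z0] := boolP (cmod z == 0).
    rewrite z0 expr0n (gtn_eqF n0) mul0r mulr_ge0 ?expR_ge0 // mulr_ge0 ?exprn_ge0 ?cmod_ge0 //.
    by rewrite wE // expR_ge0.
  have zp : 0 < cmod z by rewrite lt_neqAle eq_sym z0 cmod_ge0.
  have z1 := zd; move/unit_diskP: z1 => z1; have y1 := yd; move/unit_diskP: y1 => y1.
  have yp : 0 < cmod y by have := ge0 _ ry y1; lra.
  rewrite !wE // -!expR_logmass // -expRD ler_expR addrC.
  by apply: (logmass_le r0h r01 pd ad ac t0 tdec tlip tcvg) => //; rewrite ?ry ?zp.
- move=> n y z ry yd hyz hn.
  have y1 := yd; move/unit_diskP: y1 => y1.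
  have yp : 0 < cmod y by have := ge0 _ ry y1; lra.
  have [|zp z1 h] := logmass_near r0h r01 pd ad ac t0 tlip tcvg _ hyz hn.
    by rewrite ry.
  have zd : unit_disk z by apply/unit_diskP.
  split=> //; rewrite !wE // -!expR_logmass // -expRD ler_expR addrC.
  lra.
Qed.

End weight.

(** * The norm of peak functions *)

Section lorentz.
Context {R : realType}.

(** Products of these majorize the peak functions below, and their integrals over
    the plane factor, which avoids polar coordinates. *)
Definition lorentz (l c x : R) : R := (1 + (l * (x - c)) ^+ 2)^-1.

Lemma lorentz_gt0 l c x : 0 < lorentz l c x.
Proof. by rewrite invr_gt0 ltr_pwDl // sqr_ge0. Qed.

Lemma lorentz_continuous l c : continuous (lorentz l c).
Proof.
move=> x; apply: cvgV; first by rewrite gt_eqF // ltr_pwDl // sqr_ge0.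
apply: cvgD; first exact: cvg_cst.
apply: (@continuous_comp _ _ _ (fun x : R => l * (x - c)) (fun x => x ^+ 2)); last exact: exprn_continuous.
by apply: cvgM; [exact: cvg_cst|apply: cvgB; [exact: cvg_id|exact: cvg_cst]].
Qed.

Lemma lorentz_integral_le (l c a b : R) : 0 < l -> a < b ->
  (\int[lebesgue_measure]_(x in `[a, b]) (lorentz l c x)%:E <= (pi / l)%:E)%E.
Proof.
move=> l0 ab.
pose F x := atan (l * (x - c)) / l.
have dF (x : R) : is_derive x 1 F (lorentz l c x).
  have h1 : is_derive (l * (x - c)) 1 (@atan R) (lorentz l c x).
    by apply: DeriveDef; [exact: derivable_atan|rewrite -derive1E derive1_atan].
  have h2 : is_derive x 1 (fun x => l * (x - c)) l.
    rewrite (_ : (fun x => _) = l *: (@id R - cst c)); last by apply/funext.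
    by apply: is_derive_eq; rewrite subr0 /GRing.scale /= mulr1.
  have h3 := @is_derive1_comp _ _ (fun x => l * (x - c)) x _ _ h1 h2.
  rewrite (_ : F = l^-1 *: ((@atan R) \o (fun x => l * (x - c)))); last first.
    by apply/funext => y; rewrite /F /= mulrC.
  by apply: is_derive_eq; rewrite /GRing.scale /= mulrCA mulVf ?mulr1 // gt_eqF.
have cF : continuous F.
  by move=> x; apply: differentiable_continuous; apply/derivable1_diffP; case: (dF x).
rewrite (@continuous_FTC2 _ _ F) //.
- rewrite -EFinB lee_fin /F -mulrBl ler_pM2r ?invr_gt0 //.
  have := atan_ltpi2 (l * (b - c)); have := atan_gtNpi2 (l * (a - c)); lra.
- by apply: continuous_subspaceT; exact: lorentz_continuous.
- split.
  + by move=> x _; case: (dF x).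
  + exact: cvg_at_right_filter (cF a).
  + exact: cvg_at_left_filter (cF b).
- by move=> x _; rewrite derive1E; case: (dF x).
Qed.

Lemma lorentz_plane_integral (l c1 c2 : R) : 0 < l ->
  (\int[lebesgue_plane]_(p in disk_coord)
    (lorentz l c1 p.1 * lorentz l c2 p.2)%:E <= ((pi / l) ^+ 2)%:E)%E.
Proof.
move=> l0.
pose I := `[(-1 : R), 1]%classic : set (measurableTypeR R).
have mI : measurable I by exact: measurable_itv.
pose k c := (fun x => (lorentz l c x)%:E) \_ I.
have k0 c x : (0 <= k c x)%E by rewrite /k patchE; case: ifP; rewrite // lee_fin ltW // lorentz_gt0.
have mk c : measurable_fun [set: measurableTypeR R] (k c).
  apply: (measurable_restrictT _ mI).1; apply/measurable_EFinP.
  by apply: measurable_funTS; apply: continuous_measurable_fun; exact: lorentz_continuous.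
have intk c : (\int[lebesgue_measure]_x k c x <= (pi / l)%:E)%E.
  by rewrite -integral_mkcond; apply: lorentz_integral_le.
have intk0 c : (0 <= \int[lebesgue_measure]_x k c x)%E by apply: integral_ge0.
have mkk : measurable_fun [set: measurableTypeR R * measurableTypeR R] (fun p => k c1 p.1 * k c2 p.2)%E.
  by apply: emeasurable_funM; apply: measurableT_comp.
have mdisk := @measurable_disk_coord R.
apply: (@le_trans _ _ (\int[lebesgue_plane]_p (k c1 p.1 * k c2 p.2))%E).
  rewrite integral_mkcond; apply: ge0_le_integral => //.
  - by move=> p _; rewrite patchE; case: ifP => // _; rewrite lee_fin mulr_ge0 // ltW // lorentz_gt0.
  - apply: (measurable_restrictT _ mdisk).1; apply/measurable_EFinP; apply: measurable_funTS.
    apply: measurable_funM.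
      apply: measurableT_comp; first exact: continuous_measurable_fun (@lorentz_continuous l c1).
      exact: measurable_fst.
    apply: measurableT_comp; first exact: continuous_measurable_fun (@lorentz_continuous l c2).
    exact: measurable_snd.
  - move=> [x y] _; rewrite patchE; case: ifPn => [|_]; last exact: mule_ge0.
    rewrite inE => /unit_diskP; rewrite /pair_to_complex /= => hd.
    have hx : x \in I.
      rewrite inE /I /= in_itv /=; have := ler_cmod_Re (x +i* y); rewrite /= ler_norml; lra.
    have hy : y \in I.
      rewrite inE /I /= in_itv /=; have := ler_cmod_Im (x +i* y); rewrite /= ler_norml; lra.
    by rewrite /k !patchE hx hy EFinM.
rewrite fubini_tonelli1 //; last by move=> p; exact: mule_ge0.
rewrite /fubini_F (eq_integral (fun x => k c1 x * \int[lebesgue_measure]_y k c2 y)%E); last first.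
  by move=> x _; rewrite -(@ge0_integralZl _ _ _ _ setT measurableT (k c2)).
rewrite ge0_integralZr //.
by rewrite expr2 EFinM; apply: lee_pmul.
Qed.

End lorentz.

Section disk_integral.
Context {R : realType}.
Local Notation pc := (@pair_to_complex R).

Lemma dA_integral (f : measurableTypeR R * measurableTypeR R -> \bar R) :
  measurable_fun disk_coord f -> (forall p, disk_coord p -> (0 <= f p)%E) ->
  (\int[dA R]_(p in disk_coord) f p =
   (pi^-1)%:E * \int[lebesgue_plane]_(p in disk_coord) f p)%E.
Proof.
move=> mf f0.
exact: (@ge0_integral_mscale _ _ _ lebesgue_plane _ measurable_disk_coord _ f mf f0).
Qed.

Lemma measurable_holo_sqr (g : R[i] -> R[i]) : holomorphic_on_disk g ->
  measurable_fun (disk_coord : set (measurableTypeR R * measurableTypeR R))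
    (fun p => cmod (g (pc p)) ^+ 2).
Proof.
move=> hg; apply: plane_continuous_measurable.
  by rewrite disk_coordE; exact: open_disc.
by move=> p hp; apply: holo_sqr_continuous; exact: hg.
Qed.

End disk_integral.

Section test_function.
Context {R : realType}.
Local Notation pc := (@pair_to_complex R).

(** The average [E] of [1, q, ..., q ^+ (L - 1)] is bounded by [1 + |q| ^+ L] in two
    ways: termwise, and, after multiplication by [L * |q - 1|], by summing the
    geometric series. *)
Lemma fejer_bound (q : R[i]) (L : nat) : (0 < L)%N ->
  cmod ((\sum_(j < L) q ^+ j) / L%:R) ^+ 4 * (1 + (L%:R * cmod (q - 1)) ^+ 2) ^+ 2 <= 32 * (1 + cmod q ^+ (4 * L)).
Proof.
move=> L0; set E := cmod (_ / _).
have L0' : 0 < L%:R :> R by rewrite ltr0n.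
have cL : cmod (L%:R : R[i]) = L%:R.
  by rewrite (_ : L%:R = (L%:R : R)%:C) ?cmod_real ?ger0_norm ?ler0n // rmorph_nat.
have q0 := cmod_ge0 q; have E0 : 0 <= E by exact: cmod_ge0.
set x := cmod q in q0 *.
have xL0 : 0 <= x ^+ L by rewrite exprn_ge0.
have EE : E = cmod (\sum_(j < L) q ^+ j) / L%:R by rewrite /E cmodM cmodV cL.
have b1 : E <= 1 + x ^+ L.
  rewrite EE ler_pdivrMr //.
  have : cmod (\sum_(j < L) q ^+ j) <= \sum_(j < L) x ^+ j.
    elim/big_ind2: _ => [|u a v b hu hv|j _]; first by rewrite cmod0.
      by apply: le_trans (ler_cmodD _ _) _; exact: lerD.
    by rewrite cmodX.
  move/le_trans; apply.
  apply: (@le_trans _ _ (\sum_(j < L) (1 + x ^+ L))); last first.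
    by rewrite sumr_const card_ord mulr_natr.
  apply: ler_sum => j _; have [x1|x1] := leP x 1.
    by have := exprn_ile1 j q0 x1; lra.
  have := ler_weXn2l (ltW x1) (ltnW (ltn_ord j)); lra.
have b2 : E * (L%:R * cmod (q - 1)) <= 1 + x ^+ L.
  rewrite EE mulrA divfK ?gt_eqF // -cmodM mulrC -subrX1.
  by apply: le_trans (ler_cmodD _ _) _; rewrite cmodN cmod1 cmodX addrC.
set X := L%:R * cmod (q - 1) in b2 *.
have X0 : 0 <= X by rewrite mulr_ge0 ?cmod_ge0 // ltW.
set Y := 1 + x ^+ L in b1 b2.
have Y0 : 0 <= Y by rewrite /Y; lra.
have c1 : E ^+ 2 * (1 + X ^+ 2) <= 2 * Y ^+ 2.
  have h1 : E ^+ 2 <= Y ^+ 2 by rewrite ler_pXn2r // nnegrE.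
  have h2 : (E * X) ^+ 2 <= Y ^+ 2 by rewrite ler_pXn2r // nnegrE mulr_ge0.
  rewrite exprMn in h2; lra.
have c2 : (E ^+ 2 * (1 + X ^+ 2)) ^+ 2 <= (2 * Y ^+ 2) ^+ 2.
  by rewrite ler_pXn2r // nnegrE mulr_ge0 ?sqr_ge0 // addr_ge0 // sqr_ge0.
have c3 : Y ^+ 4 <= 8 * (1 + x ^+ (4 * L)).
  rewrite mulnC exprM /Y; move: (x ^+ L) xL0 => y y0.
  have h1 : (1 + y) ^+ 2 <= 2 * (1 + y ^+ 2) by have := sqr_ge0 (y - 1); lra.
  have h2 : ((1 + y) ^+ 2) ^+ 2 <= (2 * (1 + y ^+ 2)) ^+ 2.
    by rewrite ler_pXn2r // nnegrE ?sqr_ge0 // mulr_ge0 // addr_ge0 // sqr_ge0.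
  have h3 := sqr_ge0 (y ^+ 2 - 1).
  have -> : (1 + y) ^+ 4 = ((1 + y) ^+ 2) ^+ 2 by ring.
  lra.
have -> : E ^+ 4 * (1 + X ^+ 2) ^+ 2 = (E ^+ 2 * (1 + X ^+ 2)) ^+ 2 by ring.
lra.
Qed.

(** [2 * N] and [2 * N + 4 * L] are both within [6 / T] of [A], so the powers of
    [|q|] that [fejer_bound] produces are absorbed by the weight.  The remaining
    factor is a product of two Lorentzians of width [1 / L <= 2 * T], with
    integral of order [T ^+ 2]. *)
Lemma test_function (w : R[i] -> R) (p : R[i]) (B T A : R) :
  measurable_fun (disk_coord : set (measurableTypeR R * measurableTypeR R)) (fun q => w (pc q)) ->
  (forall z, unit_disk z -> 0 < w z) ->
  unit_disk p -> 0 < cmod p -> 0 < T -> T * 48 <= 1 -> 0 <= A -> 0 <= B ->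
  (forall (n : nat) z, (0 < n)%N -> unit_disk z -> `|n%:R - A| <= 6 / T ->
     cmod z ^+ n * w z <= B * (cmod p ^+ n * w p)) ->
  exists f : R[i] -> R[i], [/\ holomorphic_on_disk f, f p = 1 &
    (\int[dA R]_(q in disk_coord) (cmod (f (pc q)) ^+ 2 * w (pc q))%:E <=
     (256 * pi * B * w p * T ^+ 2)%:E)%E].
Proof.
move=> mw w0 pd p0 T0 T48 A0 B0 hub.
have p1 : cmod p < 1 by apply/unit_diskP.
have pn0 : p != 0 by rewrite -cmod_gt0.
(* [N] is positive because the hypothesis on the weight excludes degree 0 *)
pose L := Num.truncn T^-1; pose N := (Num.truncn (A / 2)).+1.
have Ti : T * T^-1 = 1 by rewrite divff // gt_eqF.
have Ti0 : 0 < T^-1 by rewrite invr_gt0.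
have Ti48 : 48 <= T^-1 by nra.
have [L1 L2] : L%:R <= T^-1 /\ T^-1 < L%:R + 1.
  by have := truncn_itv (ltW Ti0); rewrite -/L -natr1 => /andP[].
have L0 : (0 < L)%N by rewrite -(ltr0n R); lra.
have L0' : 0 < L%:R :> R by rewrite ltr0n.
have [N1 N2] : A / 2 < N%:R /\ N%:R <= A / 2 + 1.
  have A20 : 0 <= A / 2 by lra.
  by have := truncn_itv A20; rewrite /N -!natr1 => /andP[? ?]; split; lra.
pose E (z : R[i]) := (\sum_(j < L) (z / p) ^+ j) / L%:R.
pose f z := (z / p) ^+ N * E z ^+ 2.
have fd : holomorphic_on_disk f.
  move=> z _.
  have dq : derivable ((fun z => z / p) : R[i]^o -> R[i]^o) z 1.
    have hid : derivable (id : R[i]^o -> R[i]^o) z 1 by exact: derivable_id.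
    have hcst : derivable (cst p^-1 : R[i]^o -> R[i]^o) z 1 by exact: derivable_cst.
    exact: (derivableM hid hcst).
  have dX n := @derivable_expn _ _ _ n dq.
  have dS n : derivable ((fun z => \sum_(j < n) (z / p) ^+ j) : R[i]^o -> R[i]^o) z 1.
    elim: n => [|n ih].
      by rewrite (_ : (fun z => _) = cst 0); [exact: derivable_cst|apply/funext => y; rewrite big_ord0].
    rewrite (_ : (fun z => _) = (fun z => \sum_(j < n) (z / p) ^+ j) + (fun z => (z / p) ^+ n)); last first.
      by apply/funext => y; rewrite big_ord_recr.
    exact: (derivableD ih (dX n)).
  have hc : derivable (cst L%:R^-1 : R[i]^o -> R[i]^o) z 1 by exact: derivable_cst.
  have dE := derivableM (dS L) hc.
  have dE2 := derivableM dE dE.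
  exact: (derivableM (dX N) dE2).
exists f; split => //.
  rewrite /f /E divff // expr1n mul1r (eq_bigr (fun=> 1)); last by move=> j _; rewrite expr1n.
  by rewrite sumr_const card_ord divff ?expr1n // pnatr_eq0 -lt0n.
pose K (q : R * R) := lorentz L%:R (complex.Re p) q.1 * lorentz L%:R (complex.Im p) q.2.
have K0 q : 0 <= K q by rewrite mulr_ge0 // ltW // lorentz_gt0.
have bound q : disk_coord q -> cmod (f (pc q)) ^+ 2 * w (pc q) <= 64 * B * w p * K q.
  move=> qd; have wq := w0 _ qd.
  set z := pc q in qd wq *.
  have hn (n : nat) : (0 < n)%N -> `|n%:R - A| <= 6 / T -> cmod (z / p) ^+ n * w z <= B * w p.
    move=> n0 hn; have := hub n z n0 qd hn.
    rewrite cmodM cmodV exprMn exprVn mulrAC ler_pdivrMr ?exprn_gt0 //.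
    by rewrite -!mulrA [w p * _]mulrC.
  have h1 : cmod (z / p) ^+ (2 * N) * w z <= B * w p.
    apply: hn => //; rewrite natrM ler_norml; lra.
  have h2 : cmod (z / p) ^+ (2 * N + 4 * L) * w z <= B * w p.
    by apply: hn; [rewrite addn_gt0|rewrite natrD !natrM ler_norml; lra].
  have hE := fejer_bound (z / p) L0; rewrite /= -/(E z) in hE.
  have hX : cmod (z - p) <= cmod (z / p - 1).
    have -> : z / p - 1 = (z - p) / p by rewrite mulrBl divff.
    rewrite cmodM cmodV ler_pdivlMr // ler_piMr ?cmod_ge0 //; exact: ltW.
  set Z := 1 + (L%:R * cmod (z / p - 1)) ^+ 2 in hE.
  have KZ : (Z ^+ 2)^-1 <= K q.
    rewrite /K /lorentz -invfM lef_pV2; last 2 first.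
    - by rewrite posrE exprn_gt0 // /Z ltr_pwDl // sqr_ge0.
    - by rewrite posrE mulr_gt0 // ltr_pwDl // sqr_ge0.
    have hZ : 1 + (L%:R * cmod (z - p)) ^+ 2 <= Z.
      by rewrite lerD2l ler_pXn2r ?nnegrE ?mulr_ge0 ?cmod_ge0 ?ler_pM2l // ltW.
    have hs : (L%:R * cmod (z - p)) ^+ 2 = (L%:R * (q.1 - complex.Re p)) ^+ 2 +
        (L%:R * (q.2 - complex.Im p)) ^+ 2.
      by rewrite !exprMn cmod_sqr !ReB !ImB /= -mulrDr.
    rewrite hs in hZ.
    apply: (@le_trans _ _ ((1 + ((L%:R * (q.1 - complex.Re p)) ^+ 2 +
        (L%:R * (q.2 - complex.Im p)) ^+ 2)) ^+ 2)); last first.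
      by rewrite ler_pXn2r // nnegrE; [rewrite !addr_ge0 // sqr_ge0|apply: le_trans hZ; rewrite !addr_ge0 // sqr_ge0].
    move: (sqr_ge0 (L%:R * (q.1 - complex.Re p))) (sqr_ge0 (L%:R * (q.2 - complex.Im p))).
    move: (_ ^+ 2) (_ ^+ 2) => u v u0 v0; nra.
  have Z0 : 0 < Z ^+ 2 by rewrite exprn_gt0 // /Z ltr_pwDl // sqr_ge0.
  apply: (@le_trans _ _ (64 * B * w p * (Z ^+ 2)^-1)); last first.
    by rewrite ler_wpM2l // !mulr_ge0 // ltW // w0.
  rewrite ler_pdivlMr // /f cmodM !cmodX exprMn -!exprM.
  have -> : cmod (z / p) ^+ (N * 2) * cmod (E z) ^+ (2 * 2) * w z * Z ^+ 2 =
    (cmod (E z) ^+ 4 * Z ^+ 2) * (cmod (z / p) ^+ (2 * N) * w z) by rewrite mulnC; ring.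
  apply: (@le_trans _ _ (32 * (1 + cmod (z / p) ^+ (4 * L)) * (cmod (z / p) ^+ (2 * N) * w z))).
    by rewrite ler_wpM2r // mulr_ge0 ?exprn_ge0 ?cmod_ge0 // ltW.
  have -> : 32 * (1 + cmod (z / p) ^+ (4 * L)) * (cmod (z / p) ^+ (2 * N) * w z) =
    32 * (cmod (z / p) ^+ (2 * N) * w z + cmod (z / p) ^+ (2 * N + 4 * L) * w z).
    by rewrite exprD; ring.
  lra.
have mfw : measurable_fun (disk_coord : set (measurableTypeR R * measurableTypeR R))
   (fun q => (cmod (f (pc q)) ^+ 2 * w (pc q))%:E).
  by apply/measurable_EFinP; apply: measurable_funM => //; exact: measurable_holo_sqr.
have fw0 q : disk_coord q -> (0 <= (cmod (f (pc q)) ^+ 2 * w (pc q))%:E)%E.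
  by move=> qd; rewrite lee_fin mulr_ge0 ?sqr_ge0 // ltW // w0.
rewrite dA_integral //.
have mK : measurable_fun (disk_coord : set (measurableTypeR R * measurableTypeR R)) (fun q => (K q)%:E).
  apply/measurable_EFinP; apply: measurable_funTS; apply: measurable_funM.
    apply: measurableT_comp; first exact: continuous_measurable_fun (@lorentz_continuous _ _ _).
    exact: measurable_fst.
  apply: measurableT_comp; first exact: continuous_measurable_fun (@lorentz_continuous _ _ _).
  exact: measurable_snd.
have c0 : 0 <= 64 * B * w p by rewrite !mulr_ge0 // ltW // w0.
have I1 : (\int[lebesgue_plane]_(q in disk_coord) (cmod (f (pc q)) ^+ 2 * w (pc q))%:E <=
   (64 * B * w p)%:E * ((pi / L%:R) ^+ 2)%:E)%E.
  apply: (@le_trans _ _ (\int[lebesgue_plane]_(q in disk_coord) ((64 * B * w p)%:E * (K q)%:E))%E).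
    apply: ge0_le_integral => //.
    - exact: measurable_disk_coord.
    - exact: measurable_funeM.
  rewrite ge0_integralZl //; last 2 first.
  - exact: measurable_disk_coord.
  - by move=> q _; rewrite lee_fin.
  by rewrite lee_pmul ?lee_fin ?integral_ge0 ?lorentz_plane_integral // => q _; rewrite lee_fin.
apply: (@le_trans _ _ ((pi^-1)%:E * ((64 * B * w p)%:E * ((pi / L%:R) ^+ 2)%:E))%E).
  by rewrite lee_pmul2l // lte_fin invr_gt0 pi_gt0.
rewrite -!EFinM lee_fin.
have LT : L%:R^-1 <= 2 * T.
  have L1' : 1 <= L%:R :> R by rewrite ler1n.
  have : T * T^-1 <= T * (2 * L%:R) by rewrite ler_pM2l //; lra.
  by rewrite Ti => h1; rewrite -[X in X <= _]mul1r ler_pdivrMr //; lra.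
have LT2 : (L%:R^-1) ^+ 2 <= 4 * T ^+ 2.
  have : (L%:R^-1) ^+ 2 <= (2 * T) ^+ 2 by rewrite ler_pXn2r // nnegrE ?invr_ge0 ?ler0n // mulr_ge0 // ltW.
  lra.
have pi0 : pi != 0 :> R by rewrite gt_eqF // pi_gt0.
have Ln0 : L%:R != 0 :> R by rewrite gt_eqF.
have -> : pi^-1 * (64 * B * w p * (pi / L%:R) ^+ 2) = (64 * B * w p) * pi * (L%:R^-1) ^+ 2.
  rewrite mulrCA -[RHS]mulrA; congr (_ * _).
  by rewrite exprMn [pi ^+ 2]expr2 !mulrA mulVf // mul1r.
have -> : 256 * pi * B * w p * T ^+ 2 = (64 * B * w p) * pi * (4 * T ^+ 2) by ring.
by rewrite ler_wpM2l // mulr_ge0 // pi_ge0.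
Qed.

End test_function.

(** * The norm of point evaluations *)

Section point_evaluation.
Context {R : realType}.
Local Notation pc := (@pair_to_complex R).

(** [|z / u| ^+ (2 * N)] plays the role of the weight: on the disc of radius [T]
    about [z] it is at most [B * w u / w z], so the sub-mean value inequality for
    [g u * (z / u) ^+ N] transfers to [|g|^2 * w]. *)
Lemma point_evaluation (w : R[i] -> R) (g : R[i] -> R[i]) (z : R[i]) (B T A : R) :
  measurable_fun (disk_coord : set (measurableTypeR R * measurableTypeR R)) (fun q => w (pc q)) ->
  (forall y, unit_disk y -> 0 < w y) -> holomorphic_on_disk g -> g z = 1 ->
  unit_disk z -> 0 < cmod z -> 0 < T -> 0 <= A -> 0 < B ->
  (forall (n : nat) y, `|cmod y - cmod z| <= T -> `|n%:R - A| <= 2 ->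
     [/\ 0 < cmod y, unit_disk y & cmod z ^+ n * w z <= B * (cmod y ^+ n * w y)]) ->
  ((w z * T ^+ 2)%:E <=
   (8 * pi * B)%:E * \int[dA R]_(q in disk_coord) (cmod (g (pc q)) ^+ 2 * w (pc q))%:E)%E.
Proof.
move=> mw w0 hg gz zd z0 T0 A0 B0 hlb.
have wz := w0 _ zd.
pose N := Num.truncn (A / 2).
have hN : `|(2 * N)%:R - A| <= 2.
  have A20 : 0 <= A / 2 by lra.
  have := truncn_itv A20; rewrite -/N -(natr1 N) => /andP[h1 h2].
  by rewrite natrM ler_norml; apply/andP; split; lra.
have near y : cmod (y - z) < T ->
    [/\ 0 < cmod y, unit_disk y & cmod z ^+ (2 * N) * w z <= B * (cmod y ^+ (2 * N) * w y)].
  move=> yz; apply: hlb => //.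
  have := ler_cmodD (y - z) z; rewrite subrK.
  have := ler_cmodD (z - y) y; rewrite subrK (cmodB z).
  by rewrite ler_norml => *; apply/andP; split; lra.
pose G y := g y * (z / y) ^+ N.
have Gd y : cmod (y - z) < T -> derivable (G : R[i]^o -> R[i]^o) y 1.
  move=> /near[y0 yd _].
  have yn0 : y != 0 by rewrite -cmod_gt0.
  have hid : derivable (id : R[i]^o -> R[i]^o) y 1 by exact: derivable_id.
  have hcst : derivable (cst z : R[i]^o -> R[i]^o) y 1 by exact: derivable_cst.
  have dq : derivable ((fun y => z / y) : R[i]^o -> R[i]^o) y 1.
    exact: (derivableM hcst (derivableV yn0 hid)).
  exact: (derivableM (hg _ yd) (@derivable_expn _ _ _ N dq)).
have GE y : cmod (y - z) < T -> w z * cmod (G y) ^+ 2 <= B * (cmod (g y) ^+ 2 * w y).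
  move=> /near[y0 yd h].
  have E : cmod (G y) ^+ 2 = cmod (g y) ^+ 2 * (cmod z ^+ (2 * N) / cmod y ^+ (2 * N)).
    by rewrite /G cmodM cmodX cmodM cmodV exprMn -exprM [(N * 2)%N]mulnC exprMn exprVn.
  have -> : w z * cmod (G y) ^+ 2 = cmod (g y) ^+ 2 * (cmod z ^+ (2 * N) * w z / cmod y ^+ (2 * N)).
    by rewrite E; ring.
  rewrite [B * _]mulrCA ler_wpM2l ?sqr_ge0 // ler_pdivrMr ?exprn_gt0 //.
  by rewrite -mulrA [w y * _]mulrC.
have Gz1 : complex.Re (G z) = 1.
  by rewrite /G gz divff ?expr1n ?mulr1 // -cmod_gt0.
have T20 : 0 < T / 2 by lra.
have T2T : T / 2 < T by lra.
have := submean T20 T2T Gd Gz1.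
pose F q := (cmod (g (pc q)) ^+ 2 * w (pc q))%:E.
have mF : measurable_fun (disk_coord : set (measurableTypeR R * measurableTypeR R)) F.
  by apply/measurable_EFinP; apply: measurable_funM => //; exact: measurable_holo_sqr.
have F0 q : disk_coord q -> (0 <= F q)%E.
  by move=> qd; rewrite lee_fin mulr_ge0 ?sqr_ge0 // ltW // w0.
have sub : disc z (T / 2) `<=` disk_coord.
  by move=> q qd; have [] := near (pc q) (lt_trans qd T2T).
have mdisc := measurable_disc z (T / 2).
have mFd : measurable_fun (disc z (T / 2)) F.
  by apply: measurable_funS mF => //; exact: measurable_disk_coord.
have mGd : measurable_fun (disc z (T / 2)) (fun q => (cmod (G (pc q)) ^+ 2)%:E).
  apply/measurable_EFinP; apply: plane_continuous_measurable; first exact: open_disc.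
  by move=> q qd; apply: holo_sqr_continuous; apply: Gd; exact: lt_trans T2T.
move=> hsub.
rewrite dA_integral //.
have hF : ((w z * T ^+ 2)%:E <= (8 * B)%:E * \int[lebesgue_plane]_(q in disk_coord) F q)%E.
  apply: (@le_trans _ _ ((8 * B)%:E * \int[lebesgue_plane]_(q in disc z (T / 2)) F q)%E); last first.
    rewrite lee_pmul2l ?lte_fin ?mulr_gt0 //.
    by apply: ge0_subset_integral => //; exact: measurable_disk_coord.
  have h1 : ((w z)%:E * ((T / 2) ^+ 2 / 2)%:E <= B%:E * \int[lebesgue_plane]_(q in disc z (T / 2)) F q)%E.
    apply: (@le_trans _ _ ((w z)%:E * \int[lebesgue_plane]_(q in disc z (T / 2)) (cmod (G (pc q)) ^+ 2)%:E)%E).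
      by rewrite lee_pmul2l ?lte_fin.
    rewrite -!ge0_integralZl //; last 4 first.
    - by move=> q qd; apply: F0; exact: sub.
    - by rewrite lee_fin ltW.
    - by move=> q _; rewrite lee_fin sqr_ge0.
    - by rewrite lee_fin ltW.
    apply: ge0_le_integral => //.
    - by move=> q _; rewrite mule_ge0 // lee_fin ?sqr_ge0 // ltW.
    - exact: measurable_funeM.
    - exact: measurable_funeM.
    - by move=> q qd; rewrite -!EFinM lee_fin GE //; exact: lt_trans T2T.
  have -> : (w z * T ^+ 2)%:E = (8%:E * ((w z)%:E * ((T / 2) ^+ 2 / 2)%:E))%E.
    by rewrite -!EFinM; congr EFin; field.
  by rewrite (EFinM 8 B) -muleA lee_pmul2l // lte_fin.
apply: le_trans hF _; rewrite muleA -EFinM.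
have pi0 : pi != 0 :> R by rewrite gt_eqF // pi_gt0.
by rewrite (_ : 8 * pi * B * pi^-1 = 8 * B) // [8 * pi * B]mulrAC mulfK.
Qed.

End point_evaluation.

(** * Boundedness of the quotient *)

Section comparison.
Context {R : realType}.
Local Notation pc := (@pair_to_complex R).

Lemma A2norm_sqr_le (w : R[i] -> R) (f g : R[i] -> R[i]) (M : R) :
  (forall z, unit_disk z -> 0 < w z) -> (A2norm w g <= M%:E * A2norm w f)%E ->
  (\int[dA R]_(q in disk_coord) (cmod (g (pc q)) ^+ 2 * w (pc q))%:E <=
   (M ^+ 2)%:E * \int[dA R]_(q in disk_coord) (cmod (f (pc q)) ^+ 2 * w (pc q))%:E)%E.
Proof.
move=> w0; rewrite /A2norm.
have I0 (h : R[i] -> R[i]) : (0 <= \int[dA R]_(q in disk_coord) (cmod (h (pc q)) ^+ 2 * w (pc q))%:E)%E.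
  by apply: integral_ge0 => q qd; rewrite lee_fin mulr_ge0 ?sqr_ge0 // ltW // w0.
move: (I0 f) (I0 g); move: (integral _ _ _) (integral _ _ _) => If Ig If0 Ig0 h.
rewrite -lee_sqrt ?mule_ge0 ?lee_fin ?sqr_ge0 // sqrteM ?lee_fin ?sqr_ge0 //.
apply: (le_trans h); rewrite lee_wpmul2r ?sqrte_ge0 //.
by rewrite /= sqrtr_sqr lee_fin ler_norm.
Qed.

End comparison.

Theorem theorem3p2 (R : realType) (w : R[i] -> R) (phi : R[i] -> R[i])
  (w_regular : regular_weight w) (w_classW : classW w)
  (phi_holo : holomorphic_on_disk phi)
  (phi_disk : forall z, unit_disk z -> unit_disk (phi z))
  (C_phi_bounded : bounded_on_A2 w (composition_operator phi)) :
  forall zeta : R[i], unit_circle zeta ->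
    (limf_esup (fun z : R[i]^o => (w z / w (phi z))%:E)
       (within unit_disk (nbhs (zeta : R[i]^o))) < +oo)%E.
Proof.
have [[wint _ _] [TA2 [M hM]]] := (w_classW, C_phi_bounded).
have [a [t [r1 [B [[[r1h r11] B0 a0 t0 tdec] [w0 wdec wub wlb]]]]]] := weight_estimates w_classW.
have mw : measurable_fun (disk_coord : set (measurableTypeR R * measurableTypeR R))
    (fun q => w (pair_to_complex q)).
  by apply/measurable_EFinP; exact: (measurable_int _ wint).
have r10 : 0 < r1 by lra.
have pi0 := pi_ge0 R; have B0' := ltW B0.
(* [8 * pi * B] comes from [point_evaluation] at [z], [256 * pi * B] from
   [test_function] at [phi z], and [M ^+ 2] from the bound on [C_phi] *)
pose K : R := 8 * (256 * (pi * B * M) ^+ 2).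
have key z : unit_disk z -> r1 <= cmod z -> w z <= Num.max 1 K * w (phi z).
  move=> zd zr; have pd := phi_disk _ zd.
  have wp := w0 _ pd.
  have z1 : cmod z < 1 by apply/unit_diskP.
  have p1 : cmod (phi z) < 1 by apply/unit_diskP.
  have [pz|zp] := leP (cmod (phi z)) (cmod z).
    apply: le_trans (wdec _ _ pz zd) _.
    by rewrite ler_peMl ?(ltW wp) // le_max lexx.
  have pr : r1 <= cmod (phi z) by apply: le_trans zr (ltW zp).
  have [tp0 tp48] : 0 < t (cmod (phi z)) /\ t (cmod (phi z)) * 48 <= 1 - cmod (phi z).
    by apply: t0; rewrite pr.
  have [tz0 tz48] : 0 < t (cmod z) /\ t (cmod z) * 48 <= 1 - cmod z by apply: t0; rewrite zr.
  have pp : 0 < cmod (phi z) by lra.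
  have zpos : 0 < cmod z by lra.
  have [] := @test_function R w (phi z) B (t (cmod (phi z))) (a (cmod (phi z))) mw w0 pd pp tp0.
  - by have := cmod_ge0 (phi z); lra.
  - by apply: a0; rewrite p1 ltW.
  - exact: ltW.
  - by move=> n y n0 yd hn; apply: wub.
  move=> f [fh fp If].
  have fA2 : A2 w f.
    have sq (x : \bar R) : (x < +oo -> sqrte x < +oo)%E.
      by case: x => [r|//|_] /=; rewrite ?ltry ?lt0y.
    by split=> //; apply: sq; exact: le_lt_trans If (ltry _).
  have [gh _] := TA2 f fA2.
  have gz : composition_operator phi f z = 1 by [].
  have az : 0 <= a (cmod z) by apply: a0; rewrite z1 ltW.
  have Ig := point_evaluation mw w0 gh gz zd zpos tz0 az B0
    (fun n y hy hn => wlb n z y zr zd hy hn).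
  have Igf := A2norm_sqr_le w0 (hM f fA2).
  have : ((w z * t (cmod z) ^+ 2)%:E <= (8 * pi * B)%:E * ((M ^+ 2)%:E *
     (256 * pi * B * w (phi z) * t (cmod (phi z)) ^+ 2)%:E))%E.
    apply: (le_trans Ig); apply: lee_wpmul2l; first by rewrite lee_fin !mulr_ge0.
    by apply: (le_trans Igf); rewrite lee_wpmul2l ?lee_fin ?sqr_ge0.
  rewrite -!EFinM lee_fin => h.
  have tt : t (cmod (phi z)) ^+ 2 <= t (cmod z) ^+ 2.
    by rewrite ler_pXn2r ?nnegrE ?(ltW tp0) ?(ltW tz0) // tdec // ltW.
  have K0 : 0 <= K by rewrite /K; apply: mulr_ge0 (ler0n _ _) (mulr_ge0 (ler0n _ _) (sqr_ge0 _)).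
  apply: (@le_trans _ _ (K * w (phi z))); last first.
    by rewrite ler_wpM2r ?(ltW wp) // le_max lexx orbT.
  rewrite -(ler_pM2r (_ : 0 < t (cmod z) ^+ 2)) ?exprn_gt0 //.
  apply: (le_trans h).
  rewrite [X in X <= _](_ : _ = K * w (phi z) * t (cmod (phi z)) ^+ 2); last by rewrite /K; ring.
  by rewrite ler_wpM2l // mulr_ge0 // ltW.
move=> zeta zc.
have c1 : cmod zeta = 1.
  by move: zc; rewrite /unit_circle /= norm_cmod => /(congr1 (@complex.Re R)).
apply: (@le_lt_trans _ _ (Num.max 1 K)%:E); last by rewrite ltry.
apply: (@le_trans _ _ (ereal_sup [set (w z / w (phi z))%:E | z in
    [set z : R[i]^o | unit_disk z /\ r1 <= cmod z]])).
  apply: ereal_inf_lbound; exists [set z : R[i]^o | unit_disk z /\ r1 <= cmod z] => //.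
  apply/nbhs_cmodP; exists (1 - r1); first by rewrite subr_gt0.
  move=> z hz zd; split => //.
  have := ler_cmodD (zeta - z) z; rewrite subrK c1 cmodB; lra.
apply: ge_ereal_sup => _ [z [zd zr] <-].
by rewrite lee_fin ler_pdivrMr; [exact: key|apply: w0; exact: phi_disk].
Qed.
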